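(* Let $d\ge1$, $s\in(0,1)$, $p>\frac ds$ and $\Lambda>0$. There exist a constant $c=c(p,d,s,\Lambda)>0$ and a radius $R_0=R_0(p,d,s,\Lambda)>0$ such that the following holds. Let $\Sigma=\Sigma^d=\partial\Omega$ be the smooth boundary of a compact convex body in $\mathbb{R}^{d+1}$ with $\mathcal{W}_{s,p}(\Sigma)\le\Lambda$. Then for any $x\in\Sigma$ $$\inf_{R\in(0,R_0)}R^{-d}\,\mathcal{H}^d(\Sigma\cap B(x,R))>c .$$
   Context: For $\Sigma=\partial\Omega\subset\mathbb{R}^{d+1}$ with $\Omega$ bounded and $\Sigma$ smooth, let $n:\Sigma\to\mathbb{S}^d$ be the outward unit normal. The fractional mean curvature is $$H_{\Sigma,s}(x):=c_s\int_\Sigma\frac{\langle x-y,n(y)\rangle}{|x-y|^{d+1+s}}\,d\mathcal{H}^d(y),$$ where $c_s>0$ is a fixed normalizing constant, and the fractional Willmore energy is $\mathcal{W}_{s,p}(\Sigma):=\int_\Sigma|H_{\Sigma,s}(x)|^p\,d\mathcal{H}^d(x)$. Here $B(x,R)$ is the ball in $\mathbb{R}^{d+1}$ and $\mathcal{H}^d$ is $d$-dimensional Hausdorff measure. *)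

(* Defs.v *)
From HB Require Import structures.
From mathcomp Require Import all_boot all_order all_algebra.
From mathcomp Require Import all_classical all_reals all_analysis.

Set Implicit Arguments.
Unset Strict Implicit.
Unset Printing Implicit Defensive.

Import Order.TTheory GRing.Theory Num.Theory.
Import numFieldNormedType.Exports.

Local Open Scope classical_set_scope.
Local Open Scope ring_scope.

(* The norm that the library puts on row vectors is the sup norm: it is used
   below only through the topology it induces. Lengths, balls and diameters are
   Euclidean and go through [enorm]. *)
Definition dot {R : realType} {n : nat} (u v : 'rV[R]_n) : R :=
  \sum_(i < n) u 0 i * v 0 i.

Definition enorm {R : realType} {n : nat} (u : 'rV[R]_n) : R :=
  Num.sqrt (dot u u).

Definition eball {R : realType} {n : nat} (x : 'rV[R]_n) (r : R) :
  set 'rV[R]_n := [set y | enorm (x - y) < r].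

(* Empty set: [diam set0 = -oo]. *)
Definition diam {R : realType} {n : nat} (U : set 'rV[R]_n) : \bar R :=
  ereal_sup [set (enorm (x - y))%:E | x in U & y in U].

(* Volume of the Euclidean unit ball of R^k, i.e. pi^(k/2) / Gamma(k/2 + 1),
   by the recursion omega_(k+2) = 2 pi / (k+2) * omega_k. *)
Fixpoint ball_volume (R : realType) (k : nat) : R :=
  match k with
  | 0 => 1
  | 1 => 2
  | k'.+2 => 2 * pi / k'.+2%:R * ball_volume R k'
  end.

Definition hausdorff_weight {R : realType} {n : nat} (k : nat)
    (U : set 'rV[R]_n) : \bar R :=
  if U == set0 then 0%E
  else ((ball_volume R k / 2 ^+ k)%:E * diam U ^+ k)%E.

Definition delta_cover {R : realType} {n : nat} (delta : R)
    (A : set 'rV[R]_n) : set ((set 'rV[R]_n)^nat) :=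
  [set F | (forall i, (diam (F i) <= delta%:E)%E) /\ A `<=` \bigcup_i F i].

Definition hausdorff_pre {R : realType} {n : nat} (k : nat) (delta : R)
    (A : set 'rV[R]_n) : \bar R :=
  ereal_inf [set (\sum_(i <oo) hausdorff_weight k (F i))%E
            | F in delta_cover delta A].

Definition hausdorff {R : realType} {n : nat} (k : nat)
    (A : set 'rV[R]_n) : \bar R :=
  ereal_sup [set hausdorff_pre k delta A | delta in [set delta : R | 0 < delta]].

Section hausdorff_outer_measure.
Context {R : realType} {n : nat} (k : nat).
Local Open Scope ereal_scope.
Implicit Types (A U : set 'rV[R]_n) (delta : R).

Lemma ball_volume_ge0 j : (0 <= ball_volume R j)%R.
Proof.
suff : (0 <= ball_volume R j)%R /\ (0 <= ball_volume R j.+1)%R by case.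
elim: j => [|j [H1 H2]]; first by split => /=.
split => //=; apply: mulr_ge0 => //.
by rewrite divr_ge0 // mulr_ge0 // pi_ge0.
Qed.

Lemma diam_ge0 U : U !=set0 -> 0 <= diam U.
Proof.
move=> [x Ux]; apply: le_trans (ereal_sup_ubound _); last first.
  by exists x => //; exists x => //; reflexivity.
by rewrite lee_fin sqrtr_ge0.
Qed.

Lemma hausdorff_weight_ge0 U : 0 <= hausdorff_weight k U.
Proof.
rewrite /hausdorff_weight; case: eqP => // /eqP/set0P U0.
rewrite mule_ge0 ?expe_ge0 ?diam_ge0 // lee_fin.
by rewrite divr_ge0 ?ball_volume_ge0 // exprn_ge0.
Qed.

(* The pre-measure is the library's outer extension [mu_ext], on the discrete
   sigma-algebra, of the weight set to +oo on the sets of diameter > delta. *)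
Let D := g_sigma_algebraType [set: set 'rV[R]_n].

Let gauge delta (U : set D) : \bar R :=
  if diam (U : set 'rV[R]_n) <= delta%:E then hausdorff_weight k U else +oo.

Let gauge_ge0 delta U : 0 <= gauge delta U.
Proof. by rewrite /gauge; case: ifP => // _; exact: hausdorff_weight_ge0. Qed.

Let gauge0 delta : gauge delta set0 = 0.
Proof.
rewrite /gauge ifT ?/hausdorff_weight ?eqxx //.
rewrite /diam; apply: ge_ereal_sup => _ [x []].
Qed.

Let hausdorff_preE delta A : hausdorff_pre k delta A = mu_ext (gauge delta) A.
Proof.
apply/eqP; rewrite eq_le; apply/andP; split; last first.
  apply: le_ereal_inf_tmp => _ [F [dF AF] <-]; apply: ereal_inf_lbound.
  exists F; first by split => // i; apply: sub_sigma_algebra.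
  by apply: eq_eseriesr => i _; rewrite /gauge dF.
apply: le_ereal_inf_tmp => _ [F [_ AF] <-].
have [dF|/existsNP[i /negP dFi]] :=
    pselect (forall i, diam (F i : set 'rV[R]_n) <= delta%:E).
  apply: ereal_inf_lbound; exists F => //.
  by apply: eq_eseriesr => i _; rewrite /gauge dF.
rewrite (@eseries_pinfty _ _ xpredT i) ?leey //.
  by move=> j _; rewrite -ltNye (lt_le_trans _ (gauge_ge0 _ _)).
by rewrite /gauge (negbTE dFi).
Qed.

Let hausdorff_pre_le delta A :
  (0 < delta)%R -> hausdorff_pre k delta A <= hausdorff k A.
Proof. by move=> d0; apply: ereal_sup_ubound; exists delta. Qed.

Let hausdorff0 : hausdorff k (set0 : set 'rV[R]_n) = 0.
Proof.
have pre0 delta : hausdorff_pre k delta (set0 : set 'rV[R]_n) = 0.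
  by rewrite hausdorff_preE; apply: mu_ext0.
apply/eqP; rewrite eq_le; apply/andP; split.
  by apply: ge_ereal_sup => _ [delta _ <-]; rewrite pre0.
by rewrite -(pre0 1%R); apply: hausdorff_pre_le.
Qed.

Let hausdorff_ge0 A : 0 <= hausdorff k A.
Proof.
apply: (le_trans _ (hausdorff_pre_le A (@ltr01 R))).
by rewrite hausdorff_preE; apply: mu_ext_ge0.
Qed.

Let le_hausdorff : {homo @hausdorff R n k : A B / A `<=` B >-> A <= B}.
Proof.
move=> A B AB; apply: ge_ereal_sup => _ [delta d0 <-].
apply: (le_trans _ (hausdorff_pre_le B d0)).
by rewrite !hausdorff_preE; apply: le_mu_ext.
Qed.

Let hausdorff_sigma_subadditive : sigma_subadditive (@hausdorff R n k).
Proof.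
move=> F; apply: ge_ereal_sup => _ [delta d0 <-]; rewrite hausdorff_preE.
have := @mu_ext_sigma_subadditive _ D R _ (gauge_ge0 delta) F.
move=> /le_trans; apply.
apply: lee_nneseries => [i _ _|i _]; first exact: mu_ext_ge0.
by rewrite -hausdorff_preE; apply: hausdorff_pre_le.
Qed.

HB.instance Definition _ := isOuterMeasure.Build R 'rV[R]_n (@hausdorff R n k)
  hausdorff0 hausdorff_ge0 le_hausdorff hausdorff_sigma_subadditive.

End hausdorff_outer_measure.

(* H^k as a measure, on the sigma-algebra of its Caratheodory measurable sets
   (which contains the Borel sets); the underlying set function is
   [hausdorff k]. *)
Definition hausdorff_measure {R : realType} {n : nat} (k : nat) :
    {measure set (caratheodory_type (@hausdorff R n k)) -> \bar R} :=
  let mu : {outer_measure set 'rV[R]_n -> \bar R} := @hausdorff R n k in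
  (mu : set (caratheodory_type mu) -> \bar R).

Definition grad {R : realType} {n : nat} (f : 'rV[R]_n -> R) (x : 'rV[R]_n) :
  'rV[R]_n := \row_(i < n) 'D_(delta_mx 0 i) f x.

Fixpoint Ck {R : realType} {n : nat} (k : nat) (U : set 'rV[R]_n)
    (f : 'rV[R]_n -> R) : Prop :=
  (forall x, U x -> {for x, continuous f}) /\
  match k with
  | 0 => True
  | k'.+1 => forall i : 'I_n,
      (forall x, U x -> derivable f x (delta_mx 0 i)) /\
      Ck k' U (fun x => 'D_(delta_mx 0 i) f x)
  end.

Definition smooth {R : realType} {n : nat} (U : set 'rV[R]_n)
  (f : 'rV[R]_n -> R) : Prop := forall k, Ck k U f.

Definition boundary {T : topologicalType} (Omega : set T) : set T :=
  closure Omega `\` interior Omega.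

Definition convex_body {R : realType} {n : nat} (Omega : set 'rV[R]_n) : Prop :=
  [/\ compact Omega, convex_set Omega & interior Omega !=set0].

Definition local_defining_function {R : realType} {n : nat}
    (Omega : set 'rV[R]_n) (x : 'rV[R]_n) (U : set 'rV[R]_n)
    (f : 'rV[R]_n -> R) : Prop :=
  [/\ open U, U x, smooth U f,
      forall y, U y -> grad f y != 0 &
      forall y, U y -> (Omega y <-> f y <= 0)].

Definition smooth_boundary {R : realType} {n : nat} (Omega : set 'rV[R]_n) :
    Prop :=
  forall x, boundary Omega x -> exists U f, local_defining_function Omega x U f.

Definition is_outward_unit_normal {R : realType} {n : nat}
    (Omega : set 'rV[R]_n) (x v : 'rV[R]_n) : Prop :=
  boundary Omega x /\
  exists U f, local_defining_function Omega x U f /\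
    v = (enorm (grad f x))^-1 *: grad f x.

(* The vector is unique, and exists at every point of a smooth boundary; the
   value elsewhere is 0. *)
Definition outward_normal {R : realType} {n : nat} (Omega : set 'rV[R]_n)
    (x : 'rV[R]_n) : 'rV[R]_n :=
  xget 0 [set v | is_outward_unit_normal Omega x v].

(* Fractional mean curvature of the boundary of [Omega] in R^(d+1), with
   normalizing constant [cs]; the integrand at y = x is 0. *)
Definition frac_mean_curvature {R : realType} {d : nat} (cs s : R)
    (Omega : set 'rV[R]_d.+1) (x : 'rV[R]_d.+1) : \bar R :=
  (cs%:E * \int[hausdorff_measure d]_(y in boundary Omega)
     (dot (x - y) (outward_normal Omega y)
        / enorm (x - y) `^ (d%:R + 1 + s))%:E)%E.

Definition frac_willmore {R : realType} {d : nat} (cs s p : R)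
    (Omega : set 'rV[R]_d.+1) : \bar R :=
  (\int[hausdorff_measure d]_(x in boundary Omega)
     (`|frac_mean_curvature cs s Omega x| `^ p))%E.

(* Main.v *)
Require Import Defs.
From mathcomp Require Import all_boot all_order all_algebra.
From mathcomp Require Import all_classical all_reals all_analysis.
From mathcomp Require Import ring lra zify.

Import Order.TTheory GRing.Theory Num.Theory.
Import numFieldNormedType.Exports.

Local Open Scope classical_set_scope.
Local Open Scope ring_scope.

Set Implicit Arguments.
Unset Strict Implicit.
Unset Printing Implicit Defensive.

(** Fix a boundary point [x] and a scale [r], and look at the part of the convex
    body within distance about [r] of [x]. Every convex body contains a cube, of
    half-side [rho] say, which is as large as the body is thick: for some
    coordinate direction [j] all chords in direction [j] have length at most a
    dimensional multiple of [rho] ([cube_and_short_chords]). There are two cases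
    ([fat_or_thin]).

    If [rho] is comparable with [r], the chords issued from the cube in a
    coordinate direction close to the outward normal at [x] must end before the
    supporting hyperplane at [x], hence at boundary points within distance of
    order [r] of [x]. These points project onto a cube of dimension [d] and
    half-side [rho], so that their area is at least of order [r ^+ d]
    ([fat_area]); the constant depends on the dimension only.

    If [rho] is much smaller than [r], the body is a graph region over a cube of
    half-side [rho]: it lies between a convex lower and a concave upper
    function, at distance comparable with [rho] from each other, whose slopes are bounded
    since the cube separates them. On a convex body the integrand of the
    fractional mean curvature has a constant sign. Therefore, at a point [x] of
    the upper graph, the curvature is at least what the part of the lower graph
    below a neighbourhood of [x] contributes. This part has area of order
    [rho ^+ d], its distance to [x] is of order [rho], and its tangent planes
    keep a distance of order [rho] from [x]: the curvature is at least of order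
    [rho `^ (- s)]. Since this holds on a set of area of order [rho ^+ d], the
    Willmore energy is at least of order [rho `^ (d - s p)]
    ([willmore_ge_scale]). As [s p > d], this exceeds [Lambda] when [rho < r < R0]
    with a suitable [R0], and the second case does not occur.

    Both cases need only lower bounds for areas, with unspecified constants. They
    come from one covering argument ([hausdorff_ge_cube]); no area formula enters.
    Lower bounds for integrals need the Caratheodory measurability of closed
    sets ([closed_caratheodory]), and the geometry of the normal is the inequality
    [outward_normal_supports]. *)

(** * Hausdorff measure of sets that project onto cubes *)

Lemma card_near_int (R : realType) (M : nat) (a b : R) : 0 <= b ->
  #|[set m : 'I_M | `|m%:R - a| < b]%SET|%:R <= 2 * b + 1.
Proof.
move=> b0; pose S := [set m : 'I_M | `|m%:R - a| < b]%SET; rewrite -/S.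
have [->|[m1 Sm1]] := set_0Vmem S.
  by rewrite cards0; lra.
pose m0 : 'I_M := [arg min_(m < m1 in S) nat_of_ord m]%N.
have [Sm0 m0min] : m0 \in S /\ forall m, m \in S -> (m0 <= m)%N.
  by rewrite /m0; case: arg_minnP.
pose t := Num.truncn (2 * b).
have gap m : m \in S -> (m - m0 <= t)%N.
  move=> Sm; rewrite truncn_ge_nat; last by lra.
  rewrite natrB ?m0min//.
  move: Sm Sm0; rewrite !inE !ltr_norml => /andP[? ?] /andP[? ?]; lra.
pose f (m : 'I_M) : 'I_t.+1 := inord (m - m0)%N.
have injf : {in S &, injective f}.
  move=> m m' Sm Sm' /(congr1 (@nat_of_ord _)); rewrite /f !inordK ?ltnS ?gap// => e.
  apply/val_inj; have := m0min _ Sm; have := m0min _ Sm'; move: e => /=; lia.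
apply: (@le_trans _ _ t.+1%:R).
  by rewrite ler_nat -(card_in_imset injf) -[leqRHS]card_ord max_card.
by rewrite -natr1 lerD2r truncn_le; lra.
Qed.

(** Counting the points of a fine grid replaces Lebesgue measure: a cube of
    half-side [rho i] contains at most [(2 M rho i / l) ^ k] of the [M ^ k] points
    of a grid of mesh [2 l / M], as soon as [M rho i] is at least [l]. *)
Lemma finite_cube_cover_lb (R : realType) (k N : nat) (z : 'I_k -> R) (l : R)
    (c : nat -> 'I_k -> R) (rho : nat -> R) :
  0 < l -> (forall i, 0 < rho i) ->
  (forall u : 'I_k -> R, (forall j, `|u j - z j| <= l) ->
     exists2 i, (i < N)%N & forall j, `|u j - c i j| < rho i) ->
  l ^+ k <= \sum_(i < N) (2 * rho i) ^+ k.
Proof.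
move=> l0 rho0 cov.
pose B := \sum_(i < N) l / rho i.
have B0 : 0 <= B by apply: sumr_ge0 => i _; rewrite divr_ge0// ltW.
pose M := (Num.truncn B).+1.
have M0 : 0 < M%:R :> R by rewrite ltr0n.
have BM : B <= M%:R by have /andP[_ /ltW] := truncn_itv B0.
have lM (i : 'I_N) : l <= M%:R * rho i.
  rewrite -ler_pdivrMr//; apply: le_trans BM.
  rewrite /B (bigD1 i)//= lerDl; apply: sumr_ge0 => j _.
  by rewrite divr_ge0// ltW.
pose pos (g : {ffun 'I_k -> 'I_M}) (j : 'I_k) : R :=
  z j - l + 2 * l * ((g j)%:R / M%:R).
have posz g j : `|pos g j - z j| <= l.
  rewrite /pos ler_norml.
  have : 0 <= ((g j)%:R / M%:R : R) <= 1.
    by rewrite divr_ge0//= ler_pdivrMr// mul1r ler_nat ltnW.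
  set q := _ / _ => /andP[q0 q1].
  have lq0 : 0 <= l * q by apply: mulr_ge0 => //; exact: ltW.
  have lq1 : l * q <= l by rewrite -[leRHS]mulr1 ler_pM2l.
  by rewrite -mulrA; apply/andP; split; lra.
pose S (i : 'I_N) (j : 'I_k) : {set 'I_M} :=
  [set m : 'I_M | `|m%:R - (c i j - (z j - l)) * M%:R / (2 * l)|
                  < M%:R * rho i / (2 * l)]%SET.
have cardS i j : (#|S i j|)%:R <= 2 * (M%:R * rho i) / l.
  apply: le_trans (card_near_int _ _ _) _.
    by rewrite divr_ge0 ?mulr_ge0// ltW.
  have hM : 1 <= M%:R * rho i / l by rewrite ler_pdivlMr// mul1r.
  have -> : M%:R * rho i / (2 * l) = M%:R * rho i / l / 2.
    by rewrite invfM mulrCA mulrC.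
  have -> : 2 * (M%:R * rho i) / l = 2 * (M%:R * rho i / l) by rewrite -mulrA.
  lra.
have covS : [set: {ffun 'I_k -> 'I_M}]%SET \subset
    (\bigcup_(i < N) [set g : {ffun 'I_k -> 'I_M} | g \in family (S i)])%SET.
  apply/fintype.subsetP => g _.
  have [i iN gi] := cov _ (posz g).
  apply/finset.bigcupP; exists (Ordinal iN) => //; rewrite inE; apply/familyP => j.
  rewrite inE /=.
  have := gi j; rewrite /pos.
  have -> : (g j)%:R - (c i j - (z j - l)) * M%:R / (2 * l) =
    (z j - l + 2 * l * ((g j)%:R / M%:R) - c i j) * (M%:R / (2 * l)) :> R.
    by field; rewrite !gt_eqF.
  move=> H; rewrite normrM (ger0_norm (_ : 0 <= M%:R / (2 * l))); last first.
    by rewrite divr_ge0// ltW// mulr_gt0.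
  have -> : M%:R * rho i / (2 * l) = rho i * (M%:R / (2 * l)).
    by field; rewrite !gt_eqF.
  by rewrite ltr_pM2r// divr_gt0// mulr_gt0.
have cnt : (M ^ k)%:R <= \sum_(i < N) (2 * (M%:R * rho i) / l) ^+ k :> R.
  have /subset_leq_card := covS; rewrite cardsT card_ffun !card_ord => Hc.
  apply: (@le_trans _ _ (\sum_(i < N)
     #|[set g : {ffun 'I_k -> 'I_M} | g \in family (S i)]%SET|)%:R).
    rewrite ler_nat; apply: leq_trans Hc _.
    elim/big_rec2 : _ => [|i m A _ IH]; first by rewrite cards0.
    apply: leq_trans (leq_card_setU _ _) _; by rewrite leq_add2l.
  rewrite natr_sum; apply: ler_sum => i _.
  rewrite cardsE card_family foldrE big_map big_enum natr_prod.
  apply: (@le_trans _ _ (\prod_(j < k) (2 * (M%:R * rho i) / l))); last first.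
    by rewrite prodr_const card_ord.
  by apply: ler_prod => j _; rewrite ler0n/= cardS.
have Mk0 : 0 < (M ^ k)%:R :> R by rewrite ltr0n expn_gt0.
have lk0 : 0 < l ^+ k by rewrite exprn_gt0.
rewrite -(ler_pM2l Mk0) mulr_sumr.
rewrite -(ler_pM2r lk0) in cnt; apply: le_trans cnt _.
rewrite mulr_suml; apply: ler_sum => i _.
by rewrite natrX -!exprMn -!mulrA mulVf ?gt_eqF// mulr1 mulrCA.
Qed.

Section euclidean_norm.
Context {R : realType} {n : nat}.
Implicit Types u v x y : 'rV[R]_n.

Lemma dotDr u v w : dot u (v + w) = dot u v + dot u w.
Proof. by rewrite /dot -big_split; apply: eq_bigr => i _; rewrite mxE mulrDr. Qed.

Lemma dotC u v : dot u v = dot v u.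
Proof. by apply: eq_bigr => i _; rewrite mulrC. Qed.

Lemma dotZr a u v : dot u (a *: v) = a * dot u v.
Proof. by rewrite /dot mulr_sumr; apply: eq_bigr => i _; rewrite mxE mulrCA. Qed.

Lemma dotNr u v : dot u (- v) = - dot u v.
Proof. by rewrite -scaleN1r dotZr mulN1r. Qed.

Lemma dotNl u v : dot (- u) v = - dot u v.
Proof. by rewrite dotC dotNr dotC. Qed.

Lemma dotDl u v w : dot (u + v) w = dot u w + dot v w.
Proof. by rewrite !(dotC _ w) dotDr. Qed.

Lemma dot_ge0 u : 0 <= dot u u.
Proof. by apply: sumr_ge0 => i _; rewrite -expr2 sqr_ge0. Qed.

Lemma enorm_ge0 u : 0 <= enorm u.
Proof. exact: sqrtr_ge0. Qed.

Lemma sqr_enorm u : enorm u ^+ 2 = dot u u.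
Proof. by rewrite sqr_sqrtr ?dot_ge0. Qed.

Lemma coord_le_enorm u i : `|u 0 i| <= enorm u.
Proof.
rewrite -ler_sqr ?nnegrE ?enorm_ge0// sqr_enorm real_normK ?num_real//.
rewrite /dot (bigD1 i)//= -expr2 lerDl.
by apply: sumr_ge0 => j _; rewrite -expr2 sqr_ge0.
Qed.

Lemma enorm_le_sum u : enorm u <= \sum_i `|u 0 i|.
Proof.
have S0 (P : pred 'I_n) : 0 <= \sum_(i | P i) `|u 0 i| by exact: sumr_ge0.
rewrite -ler_sqr ?nnegrE ?enorm_ge0// sqr_enorm /dot expr2 mulr_suml.
apply: ler_sum => i _; rewrite (bigD1 i)//= mulrDr.
by rewrite -normrM ler_wpDr ?ler_norm// mulr_ge0.
Qed.

Lemma enorm_le u (m : R) : (forall i, `|u 0 i| <= m) -> enorm u <= n%:R * m.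
Proof.
move=> um; apply: le_trans (enorm_le_sum u) _.
apply: (@le_trans _ _ (\sum_(i < n) m)); first exact: ler_sum.
by rewrite sumr_const card_ord mulr_natl.
Qed.

End euclidean_norm.

Section diameter.
Context {R : realType} {n : nat}.
Implicit Types U : set 'rV[R]_n.

Lemma enorm_le_diam U x y : U x -> U y -> ((enorm (x - y))%:E <= diam U)%E.
Proof. by move=> Ux Uy; apply: ereal_sup_ubound; exists x => //; exists y. Qed.

Lemma diam_set0 : diam (set0 : set 'rV[R]_n) = -oo%E.
Proof. by apply/eqP; rewrite -leeNy_eq; apply: ge_ereal_sup => _ [x []]. Qed.

End diameter.

Lemma ball_volume_gt0 (R : realType) k : 0 < ball_volume R k.
Proof.
suff : 0 < ball_volume R k /\ 0 < ball_volume R k.+1 by case.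
elim: k => [|k [H1 H2]]; first by split => /=.
by split => //=; rewrite mulr_gt0// divr_gt0// mulr_gt0// pi_gt0.
Qed.

(** Compactness reduces a countable cover by open cubes to a finite one. *)
Lemma open_cube_cover_lb (R : realType) (k : nat) (z : 'I_k -> R) (l : R)
    (c : nat -> 'I_k -> R) (rho : nat -> R) :
  0 < l -> (forall i, 0 < rho i) ->
  (forall u : 'I_k -> R, (forall j, `|u j - z j| <= l) ->
     exists i, forall j, `|u j - c i j| < rho i) ->
  exists N, l ^+ k <= \sum_(i < N) (2 * rho i) ^+ k.
Proof.
move=> l0 rho0 cov.
pose Q := [set v : 'rV[R]_k | forall j, `[z j - l, z j + l]%classic (v ord0 j)].
have cQ : compact Q.
  apply: (@rV_compact R k (fun j => `[z j - l, z j + l]%classic)) => j.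
  exact: segment_compact.
pose O (i : nat) := ball (\row_j c i j : 'rV[R]_k) (rho i).
have OE i v : O i v <-> forall j, `|v 0 j - c i j| < rho i.
  split=> [[_ H] j|H].
    by have := H 0 j; rewrite /ball/= mxE distrC.
  by split => // a j; rewrite /ball/= mxE distrC ord1.
move: cQ; rewrite compact_cover => /(_ nat setT O) [].
- by move=> i _; exact: ball_open.
- move=> v Qv; have [|i Hi] := cov (fun j => v 0 j).
    by move=> j; have := Qv j; rewrite /= in_itv/= => ?; rewrite ler_norml; lra.
  by exists i => //; apply/OE.
move=> D _ QD; pose N := (\max_(i <- finmap.enum_fset D) i).+1.
exists N; apply: (@finite_cube_cover_lb _ _ _ z _ c) => // u uz.
have [|i /= iD /OE ui] := QD (\row_j u j).
  move=> j; rewrite /= in_itv/= mxE; have := uz j; rewrite ler_norml; lra.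
exists i; last by move=> j; have := ui j; rewrite mxE.
by rewrite ltnS; exact: (leq_bigmax_seq (F := id)).
Qed.

Definition area_const (R : realType) (k : nat) : R :=
  ball_volume R k / 2 ^+ k * (4 ^- k / 2).

Lemma area_const_gt0 (R : realType) k : 0 < area_const R k.
Proof.
by rewrite !(mulr_gt0, divr_gt0, invr_gt0, exprn_gt0, ball_volume_gt0).
Qed.

(** Each set of a cover projects into an open cube whose half-side is about its
    diameter, so that a cover of [A] yields a cover of the cube onto which the
    coordinates [p] map [A]. *)
Lemma hausdorff_ge_cube (R : realType) (n k : nat) (p : 'I_k -> 'I_n)
    (A : set 'rV[R]_n) (z : 'I_k -> R) (l : R) :
  (0 < k)%N -> 0 < l ->
  (forall u : 'I_k -> R, (forall j, `|u j - z j| <= l) ->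
     exists2 y, A y & forall j, y 0 (p j) = u j) ->
  ((area_const R k * l ^+ k)%:E <= hausdorff k A)%E.
Proof.
move=> k0 l0 surj.
apply: (@le_trans _ _ (hausdorff_pre k 1 A)); last first.
  by apply: ereal_sup_ubound; exists 1 => //=.
apply: le_ereal_inf_tmp => _ [F [F1 AF] <-].
pose D i : R := if F i == set0 then 0 else fine (diam (F i)).
have DE i : F i !=set0 -> diam (F i) = (D i)%:E.
  move=> /[dup] /set0P /negbTE F0 Fi; rewrite /D F0 fineK// fin_numE.
  have d0 := diam_ge0 Fi; have d1 := F1 i.
  by rewrite -ltey -ltNye (lt_le_trans _ d0) ?(le_lt_trans d1) ?ltry ?ltNyr.
have D0 i : 0 <= D i.
  rewrite /D; case: eqP => // /eqP/set0P Fi.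
  by rewrite fine_ge0 ?diam_ge0.
have wE i : hausdorff_weight k (F i) = (ball_volume R k / 2 ^+ k * D i ^+ k)%:E.
  rewrite /hausdorff_weight; case: ifPn => [F0|/set0P Fi].
    by rewrite /D F0 expr0n -[k == 0%N]negbK -lt0n k0 mulr0.
  by rewrite DE// -EFin_expe EFinM.
(* Open cubes need positive radii even where the diameter is 0. The cover bounds
   the sum of the D i ^+ k + eta i from below by 4 ^- k * l ^+ k, and the terms
   eta i take at most half of that. *)
pose e : R := Num.min 1 (4 ^- k * l ^+ k / 2).
have e0 : 0 < e by rewrite lt_min ltr01/= !(mulr_gt0, invr_gt0, exprn_gt0).
pose eta i : R := e / 2 ^+ i.+1.
have eta0 i : 0 < eta i by rewrite divr_gt0 ?exprn_gt0.
have eta1 i : eta i <= 1.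
  rewrite /eta ler_pdivrMr ?exprn_gt0// mul1r.
  by apply: (@le_trans _ _ 1); rewrite ?ge_min ?lexx// exprn_ege1// ler1n.
pose rho i := 2 * Num.max (D i) (eta i).
have rho0 i : 0 < rho i by rewrite mulr_gt0// lt_max eta0 orbT.
pose ctr i : 'rV[R]_n := xget 0 (F i).
have [|N HN] := @open_cube_cover_lb _ k z l (fun i j => ctr i 0 (p j)) rho l0 rho0.
  move=> u /surj [y Ay yu]; have [i _ Fy] := AF _ Ay; exists i => j.
  rewrite -yu.
  have Fc : F i (ctr i) by apply: xgetI Fy.
  have := enorm_le_diam Fy Fc; rewrite DE; last by exists y.
  rewrite lee_fin => yD.
  have := coord_le_enorm (y - ctr i) (p j); rewrite !mxE => /le_trans/(_ yD).
  have : D i <= Num.max (D i) (eta i) by rewrite le_max lexx.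
  have : 0 < Num.max (D i) (eta i) by rewrite lt_max eta0 orbT.
  rewrite /rho; lra.
have step (i : 'I_N) : (2 * rho i) ^+ k <= 4 ^+ k * (D i ^+ k + eta i).
  have -> : 2 * rho i = 4 * Num.max (D i) (eta i) by rewrite /rho mulrA -natrM.
  rewrite exprMn ler_pM2l ?exprn_gt0//.
  have ek : eta i ^+ k <= eta i.
    by rewrite -[leRHS]expr1; apply: ler_wiXn2l => //; exact: ltW.
  have := exprn_ge0 k (D0 i); have := ltW (eta0 i).
  case: (leP (D i) (eta i)) => _; lra.
have sum_eta M : \sum_(i < M) eta i <= e.
  suff -> : \sum_(i < M) eta i = e * (1 - 2 ^- M).
    by rewrite -[leRHS]mulr1 ler_pM2l// gerBl invr_ge0 exprn_ge0.
  elim: M => [|M IH]; first by rewrite big_ord0 expr0 invr1 subrr mulr0.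
  rewrite big_ord_recr/= IH /eta exprS invfM.
  by field; rewrite expf_neq0.
have key : 4 ^- k * l ^+ k / 2 <= \sum_(i < N) D i ^+ k.
  have : l ^+ k <= 4 ^+ k * (\sum_(i < N) D i ^+ k + e).
    apply: le_trans HN _; apply: le_trans (ler_sum _ (fun i _ => step i)) _.
    by rewrite -mulr_sumr ler_pM2l ?exprn_gt0// big_split/= lerD2l sum_eta.
  rewrite -ler_pdivrMl ?exprn_gt0// => H.
  have : e <= 4 ^- k * l ^+ k / 2 by rewrite ge_min lexx orbT.
  lra.
apply: (@le_trans _ _ (\sum_(0 <= i < N) hausdorff_weight k (F i))%E); last first.
  by apply: nneseries_lim_ge => i _ _; exact: hausdorff_weight_ge0.
rewrite big_mkord; under eq_bigr do rewrite wE.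
rewrite sumEFin lee_fin -mulr_sumr.
rewrite /area_const -mulrA ler_pM2l; last first.
  by rewrite divr_gt0 ?ball_volume_gt0 ?exprn_gt0.
by rewrite mulrAC.
Qed.

(** * Closed sets are measurable *)

Lemma mx_norm_leP (R : realType) (n : nat) (u : 'rV[R]_n) (e : R) : 0 <= e ->
  `|u| <= e <-> forall i, `|u 0 i| <= e.
Proof.
move=> e0; rewrite /Num.norm/= mx_normrE; split=> [ue i|ue].
  exact: le_trans (le_bigmax _ (fun ij => `|u ij.1 ij.2|) (0, i)) ue.
by apply: bigmax_le => // -[i j] _ /=; rewrite ord1; exact: ue.
Qed.

Lemma mx_norm_le_enorm (R : realType) (n : nat) (u : 'rV[R]_n) :
  `|u| <= enorm u.
Proof. by apply/mx_norm_leP => [|i]; rewrite ?enorm_ge0 ?coord_le_enorm. Qed.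

Section closed_caratheodory.
Context {R : realType} {n : nat} (k : nat).
Local Open Scope ereal_scope.
Implicit Types A B C X : set 'rV[R]_n.
Let H := @hausdorff R n k.

Lemma le_hausdorff_pre A (d1 d2 : R) : (d1 <= d2)%R ->
  hausdorff_pre k d2 A <= hausdorff_pre k d1 A.
Proof.
move=> d12; apply: ereal_inf_le_tmp => _ [F [Fd AF] <-]; exists F => //.
by split => // i; rewrite (le_trans (Fd i)) ?lee_fin.
Qed.

(** A set of diameter less than [e] meets at most one of two sets at distance
    [e], so that a cover of the union splits into two disjoint covers. *)
Lemma hausdorff_pre_separated A B (e d : R) : (d < e)%R ->
  (forall x y, A x -> B y -> (e <= `|x - y|)%R) ->
  hausdorff_pre k d A + hausdorff_pre k d B <= hausdorff_pre k d (A `|` B).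
Proof.
move=> de sep; apply: le_ereal_inf_tmp => _ [F [Fd ABF] <-].
pose G A i := if pselect (F i `&` A !=set0) then F i else set0.
have Gcov A' : A' `<=` A `|` B -> delta_cover d A' (G A').
  move=> A'AB; split=> [i|x A'x].
    rewrite /G; case: pselect => //= _.
    by rewrite diam_set0 leNye.
  have [i _ Fx] := ABF _ (A'AB _ A'x); exists i => //.
  by rewrite /G; case: pselect => // -[]; exists x.
have preG A' : A' `<=` A `|` B ->
    hausdorff_pre k d A' <= \sum_(i <oo) hausdorff_weight k (G A' i).
  by move=> A'AB; apply: ereal_inf_lbound; exists (G A') => //; exact: Gcov.
apply: le_trans (leeD (preG A _) (preG B _)) _ => //.
have w0 A' i : 0 <= hausdorff_weight k (G A' i) by exact: hausdorff_weight_ge0.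
rewrite -nneseriesD//; apply: lee_nneseries => [i _ _|i _]; first exact: adde_ge0.
have weight0 : hausdorff_weight k (set0 : set 'rV[R]_n) = 0.
  by rewrite /hausdorff_weight eqxx.
have := @hausdorff_weight_ge0 R n k (F i).
rewrite /G; case: pselect => [[x [Fx Ax]]|nA]; case: pselect => [[y [Fy By]]|nB] /=;
  rewrite ?weight0 ?adde0 ?add0e//.
exfalso; have := enorm_le_diam Fx Fy; move=> /le_trans/(_ (Fd i)).
rewrite lee_fin => /(le_trans (mx_norm_le_enorm _)).
by move=> /(le_trans (sep _ _ Ax By)); rewrite leNgt de.
Qed.

Lemma hausdorff_separated A B (e : R) : (0 < e)%R ->
  (forall x y, A x -> B y -> (e <= `|x - y|)%R) ->
  H A + H B <= H (A `|` B).
Proof.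
move=> e0 sep; have [->|ABfin] := eqVneq (H (A `|` B)) +oo; first exact: leey.
have le_fin A' : A' `<=` A `|` B -> H A' \is a fin_num.
  move=> /(le_outer_measure H) leH.
  rewrite ge0_fin_numE ?outer_measure_ge0//.
  by apply: le_lt_trans leH _; rewrite ltey.
have Bfin : H B \is a fin_num by exact: le_fin.
have pre_fin d : (0 < d)%R -> hausdorff_pre k d A \is a fin_num.
  move=> d0; rewrite ge0_fin_numE; last first.
    by apply: le_ereal_inf_tmp => _ [F _ <-]; apply: nneseries_ge0 => *;
      exact: hausdorff_weight_ge0.
  apply: (@le_lt_trans _ _ (H A)); first by apply: ereal_sup_ubound; exists d.
  by rewrite ltey_eq le_fin.
rewrite -leeBrDr//; apply: ge_ereal_sup => _ [d1 /= d10 <-].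
rewrite leeBrDr// addeC -leeBrDr ?pre_fin//; apply: ge_ereal_sup => _ [d2 /= d20 <-].
rewrite leeBrDr ?pre_fin// addeC.
pose d := Num.min (Num.min d1 d2) (e / 2)%R.
have d0 : (0 < d)%R by rewrite !lt_min d10 d20 divr_gt0.
apply: (@le_trans _ _ (hausdorff_pre k d A + hausdorff_pre k d B)).
  by apply: leeD; apply: le_hausdorff_pre; rewrite !ge_min lexx ?orbT.
apply: (@le_trans _ _ (hausdorff_pre k d (A `|` B))).
  apply: hausdorff_pre_separated sep.
  by apply: (@le_lt_trans _ _ (e / 2)%R); rewrite ?ge_min ?lexx ?orbT//; lra.
by apply: ereal_sup_ubound; exists d.
Qed.

(** Caratheodory's criterion for metric outer measures. The points of [X] off
    [C] are exhausted by the sets [Y m] at distance at least 1/(m+1) from [C];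
    rings [Y m.+1 `\` Y m] of indices two apart are separated, so that their
    measures are summable and the exhaustion is continuous along [H]. *)
Lemma closed_caratheodory C : closed C -> H.-caratheodory C.
Proof.
move=> clC; apply: le_caratheodory_measurable => X.
change (H (X `&` C) + H (X `&` ~` C) <= H X).
have [->|Xfin] := eqVneq (H X) +oo; first exact: leey.
pose Y m := [set y | X y /\ forall c, C c -> (m.+1%:R^-1 <= `|y - c|)%R].
pose B m := Y m.+1 `\` Y m.
have YX m : Y m `<=` X by move=> y [].
have Ymono m m' : (m <= m')%N -> Y m `<=` Y m'.
  move=> mm' y [Xy yC]; split=> // c /yC; apply: le_trans.
  by rewrite lef_pV2 ?posrE ?ltr0n// ler_nat ltnS.
have sepB m : H (Y m) + H (B m.+1) <= H (Y m.+2).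
  apply: (@le_trans _ _ (H (Y m `|` B m.+1))); last first.
    apply: le_outer_measure => y [|[]//].
    by apply: Ymono; rewrite leqW// leqW.
  pose e : R := (m.+1%:R^-1 - m.+2%:R^-1)%R.
  have e0 : (0 < e)%R by rewrite subr_gt0 ltf_pV2 ?posrE ?ltr0n// ltr_nat.
  apply: (hausdorff_separated e0) => x y [Xx xC] [[Xy _] nYy].
  have [c [Cc yc]] : exists c, C c /\ (`|y - c| < m.+2%:R^-1)%R.
    apply: contrapT => nc; apply: nYy; split => // c Cc.
    by rewrite leNgt; apply/negP => yc; apply: nc; exists c.
  rewrite /e lerBlDr (le_trans (xC _ Cc))// (le_trans (ler_distD y x c))//.
  by rewrite lerD2l ltW.
have B_ge0 m : 0 <= H (B m) by exact: outer_measure_ge0.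
have sumB N : \sum_(0 <= j < N) H (B j.+1) <= H (Y N) + H (Y N.+1).
  elim: N => [|N IH]; first by rewrite big_nil adde_ge0 ?outer_measure_ge0.
  rewrite big_nat_recr//= (le_trans (leeD2r _ IH))//.
  by rewrite addeAC addeC leeD2l// sepB.
have sumBfin : \sum_(j <oo) H (B j.+1) < +oo.
  apply: (@le_lt_trans _ _ (H X + H X)); last first.
    by rewrite lte_add_pinfty// ltey.
  apply: lime_le; first exact: is_cvg_nneseries.
  by apply: nearW => N; rewrite (le_trans (sumB N))// leeD// le_outer_measure.
have main N : H (X `&` C) + H (X `&` ~` C) <=
    H X + \sum_(N <= j <oo) H (B j.+1).
  have XC : X `&` ~` C `<=` Y N.+1 `|` \bigcup_(j in ~` `I_N) B j.+1.
    move=> y [Xy Cy].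
    have [m Ym] : exists m, Y m y.
      have : nbhs y (~` C) by apply: open_nbhs_nbhs; split => //; exact: closed_openC.
      move=> /nbhs_ballP[e /= e0 yC].
      exists (Num.truncn e^-1); split => // c Cc.
      rewrite leNgt; apply/negP => yc; apply: (yC c) => //.
      rewrite -ball_normE /=; apply: lt_trans yc _.
      rewrite invf_plt ?posrE ?ltr0n//.
      have ei0 : (0 <= e^-1)%R by rewrite invr_ge0 ltW.
      by have /andP[] := truncn_itv ei0.
    elim: m Ym => [|m IH] Ym; first by left; exact: Ymono Ym.
    have [Ym'|nYm] := pselect (Y m y); first exact: IH.
    have [mN|Nm] := leqP m.+1 N.+1; first by left; exact: Ymono Ym.
    right; exists m.-1; first by rewrite /= /setC/=; apply/negP; rewrite -leqNgt; lia.
    by rewrite prednK//; lia.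
  apply: (@le_trans _ _ (H (X `&` C) + (H (Y N.+1) +
    \sum_(N <= j <oo) H (B j.+1)))).
    rewrite leeD2l// (le_trans (le_outer_measure H _ _ XC))//.
    rewrite (le_trans (outer_measureU2 _ _ _))// leeD2l//.
    exact: outer_measure_sigma_subadditive_tail.
  rewrite addeA leeD2r//; apply: (@le_trans _ _ (H (X `&` C `|` Y N.+1))).
    apply: (@hausdorff_separated _ _ N.+2%:R^-1); first by rewrite invr_gt0 ltr0n.
    by move=> x y [_ Cx] [_ yC]; rewrite distrC yC.
  by apply: le_outer_measure => y [[]//|[]].
have Hlim : H X + \sum_(N <= j <oo) H (B j.+1) @[N --> \oo] --> H X + 0.
  apply: cvgeD.
  - exact: fin_num_adde_defl.
  - exact: cvg_cst.
  - by apply: nneseries_tail_cvg => // j _; exact: B_ge0.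
by rewrite adde0 in Hlim; apply: (cvge_ge _ Hlim); apply: nearW => N; exact: main.
Qed.

End closed_caratheodory.

(** * Supporting hyperplanes of smooth convex bodies *)

Section c1_functions.
Context {R : realType} {n : nat}.
Implicit Types (U : set 'rV[R]_n) (f : 'rV[R]_n -> R) (x y v w : 'rV[R]_n).
Local Notation e_ i := (delta_mx 0 i : 'rV[R]_n).

Lemma is_derive_line f (b v : 'rV[R]_n) (s : R) : derivable f (b + s *: v) v ->
  is_derive s 1 (fun t => f (b + t *: v)) ('D_v f (b + s *: v)).
Proof.
have E : (fun h : R => h^-1 *: (((fun t => f (b + t *: v)) \o shift s) (h *: 1)
                               - f (b + s *: v))) =
         (fun h => h^-1 *: ((f \o shift (b + s *: v)) (h *: v) - f (b + s *: v))).
  apply/funext => h /=; congr (_ *: (f _ - _)).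
  by rewrite /shift /= [h *: 1]mulr1 scalerDl addrCA.
move=> df; constructor; first by rewrite /derivable E.
by rewrite /derive E.
Qed.

Lemma partial_mean_value f (b v : 'rV[R]_n) (t : R) :
  (forall s, `|s| <= `|t| -> derivable f (b + s *: v) v) ->
  exists2 s, `|s| <= `|t| &
    f (b + t *: v) - f b = t * 'D_v f (b + s *: v).
Proof.
move=> df; pose g s := f (b + s *: v).
have E0 : f b = g 0 by rewrite /g scale0r addr0.
have Dg (s : R) : `|s| <= `|t| -> is_derive s 1 g ('D_v f (b + s *: v)).
  by move=> st; apply: is_derive_line; exact: df.
have Cg a c : (forall s, s \in `[a, c] -> `|s| <= `|t|) ->
    {within `[a, c], continuous g}.
  move=> act; apply: derivable_within_continuous => s /act st.
  by have [] := Dg _ st.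
have [t0|t0] := leP 0 t.
- have ict s : s \in `[0, t] -> `|s| <= `|t|.
    by rewrite in_itv/= => /andP[s0 st]; rewrite !ger0_norm.
  have Di s : s \in `]0, t[ -> is_derive s 1 g ('D_v f (b + s *: v)).
    by move=> /subset_itv_oo_cc /ict; exact: Dg.
  have [s s0t] := MVT_segment t0 Di (Cg _ _ ict).
  by rewrite subr0 mulrC E0 => ?; exists s => //; exact: ict.
- have ict s : s \in `[t, 0] -> `|s| <= `|t|.
    rewrite in_itv/= => /andP[s0 st].
    by rewrite !ler0_norm ?lerN2// ltW.
  have Di s : s \in `]t, 0[ -> is_derive s 1 g ('D_v f (b + s *: v)).
    by move=> /subset_itv_oo_cc /ict; exact: Dg.
  have [s s0t] := MVT_segment (ltW t0) Di (Cg _ _ ict).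
  rewrite sub0r mulrN mulrC E0 => H; exists s; first exact: ict.
  by rewrite -opprB H opprK.
Qed.

(** The increment is split along the coordinate axes, and the mean value theorem
    applied to each part. *)
Lemma C1_first_order U f y (eta : R) : open U -> U y -> Ck 1 U f -> 0 < eta ->
  \forall x \near y, U x /\
    `|f x - f y - dot (grad f y) (x - y)| <= eta * \sum_i `|(x - y) 0 i|.
Proof.
move=> oU Uy [_ C1] eta0.
have : \forall x \near y, U x /\
    forall i, `|'D_(e_ i) f x - 'D_(e_ i) f y| <= eta.
  suff D1 : \forall x \near y, forall i, `|'D_(e_ i) f x - 'D_(e_ i) f y| <= eta.
    exact: (filterS2 _ _ (open_nbhs_nbhs (conj oU Uy)) D1).
  apply: (@filter_forall _ _
    (fun i x => `|'D_(e_ i) f x - 'D_(e_ i) f y| <= eta) _ (nbhs_filter y)) => i.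
  have [_ [/(_ _ Uy) ci _]] := C1 i.
  near=> x; rewrite distrC ltW//; near: x.
  by move/cvgrPdist_lt: ci; apply.
move=> /nbhs_ballP[r /= r0 yr].
apply/nbhs_ballP; exists r => //= x yx; split; first by have [] := yr _ yx.
have [w wE] : exists w, w = x - y by exists (x - y).
rewrite -wE; have wr i : `|w 0 i| < r.
  move: yx; rewrite -ball_normE /= distrC -wE; apply: le_lt_trans.
  by apply: (iffLR (mx_norm_leP w (normr_ge0 _))).
pose P (k : nat) : 'rV[R]_n := \row_i (if (i < k)%N then w 0 i else 0).
have P0 : P 0%N = 0 by apply/rowP => i; rewrite !mxE ltn0.
have Pn : y + P n = x.
  by apply/rowP => i; rewrite !mxE ltn_ord wE !mxE addrCA subrr addr0.
have Pball (k : 'I_n) s : `|s| <= `|w 0 k| -> ball y r (y + P k + s *: e_ k).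
  move=> sw; rewrite -ball_normE /= -addrA opprD addrA subrr sub0r normrN.
  apply: (@le_lt_trans _ _ (\big[Order.max/0]_i `|w 0 i|)).
    apply/mx_norm_leP; first exact: bigmax_ge_id.
    move=> i; rewrite !mxE; apply: le_trans (le_bigmax _ (fun i => `|w 0 i|) i) => /=.
    have [->|ik] := eqVneq i k; first by rewrite ltnn mulr1 add0r.
    by rewrite mulr0 addr0; case: ifP => _ //; rewrite normr0 normr_ge0.
  by apply: bigmax_lt.
have stepP (k : 'I_n) : `|f (y + P k.+1) - f (y + P k) - w 0 k * 'D_(e_ k) f y|
    <= eta * `|w 0 k|.
  have -> : P k.+1 = P k + w 0 k *: e_ k.
    apply/rowP => i; rewrite !mxE eqxx/= ltnS leq_eqVlt.
    have [->|ik] := eqVneq i k; first by rewrite eqxx ltnn add0r mulr1.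
    by rewrite (inj_eq val_inj) (negbTE ik) mulr0 addr0.
  have [|s sw] := @partial_mean_value f (y + P k) (e_ k) (w 0 k).
    by move=> s sw; apply: (C1 k).1; have [] := yr _ (Pball k s sw).
  rewrite addrA => ->; rewrite -mulrBr normrM mulrC ler_wpM2r//.
  by have [_ ->] := yr _ (Pball k s sw).
have -> : f x - f y - dot (grad f y) w =
    \sum_(k < n) (f (y + P k.+1) - f (y + P k) - w 0 k * 'D_(e_ k) f y).
  rewrite sumrB; congr (_ - _).
    rewrite -(big_mkord xpredT (fun k => f (y + P k.+1) - f (y + P k))).
    by rewrite telescope_sumr// Pn P0 addr0.
  by apply: eq_bigr => k _; rewrite mxE mulrC.
apply: le_trans (ler_norm_sum _ _ _) _.
by rewrite mulr_sumr; apply: ler_sum.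
Unshelve. all: by end_near.
Qed.

End c1_functions.

Section convex_bodies.
Context {R : realType} {n : nat}.
Implicit Types (Omega : set 'rV[R]_n) (x y v w : 'rV[R]_n).

Lemma convex_segment Omega x y (t : R) : convex_set Omega -> Omega x -> Omega y ->
  0 <= t <= 1 -> Omega (x + t *: (y - x)).
Proof.
move=> cO Ox Oy /andP[t0 t1].
have := cO y x (Itv01 t0 t1); rewrite !inE => /(_ Oy Ox).
rewrite /conv /=; congr (Omega _).
rewrite /unstable.onem.
by rewrite scalerBr scalerBl scale1r addrCA.
Qed.

(** Along the segment from [x] to a point of [Omega] the defining function
    starts from a nonnegative value and stays nonpositive, whence the sign of its
    derivative. *)
Lemma defining_function_supports Omega x U (f : 'rV[R]_n -> R) w :
  closed Omega -> convex_set Omega -> boundary Omega x ->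
  local_defining_function Omega x U f -> Omega w ->
  dot (grad f x) (w - x) <= 0.
Proof.
move=> clO cO [Ox iOx] [oU Ux sf _ fO] Ow.
have {}Ox : Omega x by move: Ox; rewrite -(closure_id Omega).1.
have fx0 : 0 <= f x.
  rewrite leNgt; apply/negP => fx0; apply: iOx.
  have cf : {for x, continuous f} := (sf 0%N).1 _ Ux.
  have fx : \forall y \near x, f y < 0 by exact: (cvgr_lt _ cf).
  apply: filterS2 (open_nbhs_nbhs (conj oU Ux)) fx => y Uy fy.
  by apply/fO => //; exact: ltW.
set v := w - x; rewrite leNgt; apply/negP => gv0.
pose S := \sum_i `|v 0 i|.
have S0 : 0 <= S by exact: sumr_ge0.
have S1 : 0 < S + 1 by rewrite ltr_wpDl.
pose eta := dot (grad f x) v / (S + 1).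
have eta0 : 0 < eta by rewrite divr_gt0.
have := C1_first_order oU Ux (sf 1%N) eta0.
move=> /nbhs_ballP[r /= r0 xr].
pose t := Num.min 1 (r / (`|v| + 1)).
have v1 : 0 < `|v| + 1 by rewrite ltr_wpDl.
have t0 : 0 < t by rewrite lt_min ltr01 divr_gt0.
have [|Uy] := xr (x + t *: v).
  rewrite -ball_normE /= opprD addrA subrr sub0r normrN normrZ gtr0_norm//.
  rewrite -(ltr_pM2r v1) in t0.
  apply: (@le_lt_trans _ _ (r / (`|v| + 1) * `|v|)).
    by rewrite ler_wpM2r// ge_min lexx orbT.
  by rewrite mulrAC ltr_pdivrMr// ltr_pM2l// ltrDl.
have Oy : Omega (x + t *: v).
  by apply: convex_segment => //; rewrite ltW//= ge_min lexx.
have fy0 : f (x + t *: v) <= 0 by apply/fO.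
have -> : x + t *: v - x = t *: v by rewrite addrC addKr.
rewrite dotZr.
have -> : \sum_i `|(t *: v) 0 i| = t * S.
  by rewrite mulr_sumr; apply: eq_bigr => i _; rewrite mxE normrM gtr0_norm.
have E : dot (grad f x) v = eta * (S + 1) by rewrite divfK// gt_eqF.
have te0 : 0 < t * eta by exact: mulr_gt0.
by rewrite ler_norml E mulrDr mulr1 mulrDr (mulrCA eta) => /andP[]; lra.
Qed.

Lemma outward_normalP Omega x : smooth_boundary Omega -> boundary Omega x ->
  is_outward_unit_normal Omega x (outward_normal Omega x).
Proof.
move=> sO bx; rewrite /outward_normal; case: xgetP => // /(_ _)/=.
have [U [f Uf]] := sO _ bx => /(_ ((enorm (grad f x))^-1 *: grad f x))[].
by split=> //; exists U, f.
Qed.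

Lemma outward_normal_unit Omega x : smooth_boundary Omega -> boundary Omega x ->
  dot (outward_normal Omega x) (outward_normal Omega x) = 1.
Proof.
move=> sO bx; have [_ [U [f [[_ Ux _ g0 _] ->]]]] := outward_normalP sO bx.
have {}g0 := g0 _ Ux.
rewrite dotZr dotC dotZr mulrA -sqr_enorm -expr2 -exprMn mulVf ?expr1n//.
rewrite gt_eqF// lt_neqAle enorm_ge0 andbT eq_sym.
apply: contra g0 => /eqP g0; apply/eqP/rowP => i.
have := coord_le_enorm (grad f x) i; rewrite g0 normr_le0 => /eqP ->.
by rewrite [RHS]mxE.
Qed.

Lemma outward_normal_supports Omega x w :
  closed Omega -> convex_set Omega -> smooth_boundary Omega ->
  boundary Omega x -> Omega w -> dot (w - x) (outward_normal Omega x) <= 0.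
Proof.
move=> clO cO sO bx Ow.
have [_ [U [f [Uf ->]]]] := outward_normalP sO bx.
rewrite dotZr dotC mulr_ge0_le0 ?invr_ge0 ?enorm_ge0//.
exact: defining_function_supports Uf Ow.
Qed.

(** The last point of the ray in the compact set is a boundary point. *)
Lemma ray_meets_boundary Omega w v : compact Omega -> Omega w -> v != 0 ->
  exists2 t, 0 <= t & boundary Omega (w + t *: v).
Proof.
move=> cO Ow v0.
have clO : closed Omega by apply: compact_closed => //; exact: norm_hausdorff.
pose T := [set t : R | 0 <= t /\ Omega (w + t *: v)].
have T0 : T 0 by split=> //; rewrite scale0r addr0.
have [M [_ HM]] : bounded_set Omega by exact: compact_bounded.
have nv0 : 0 < `|v| by rewrite normr_gt0.
have Tub : ubound T ((M + 1 + `|w|) / `|v|).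
  move=> t [t0 Ot]; rewrite ler_pdivlMr//.
  have wtM : `|w + t *: v| <= M + 1 by apply: HM Ot; rewrite ltrDl.
  have -> : t * `|v| = `|(w + t *: v) - w| by rewrite addrC addKr normrZ ger0_norm.
  by rewrite (le_trans (ler_normB _ _))// lerD2r.
have supT : has_sup T by split; [exists 0|exists ((M + 1 + `|w|) / `|v|)].
have le_sup t : T t -> t <= sup T by move=> ?; exact: (ub_le_sup supT.2).
have s0 : 0 <= sup T by exact: le_sup.
exists (sup T) => //.
have cont : {for sup T, continuous (fun t : R => w + t *: v)}.
  by apply: cvgD; [exact: cvg_cst|apply: cvgZr_tmp; exact: cvg_id].
split.
  move=> B /cont [e /= e0 Be].
  have [t Tt tsup] := sup_adherent e0 supT.
  exists (w + t *: v); split; first by case: Tt.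
  apply: Be; rewrite /= ger0_norm; first by lra.
  by rewrite subr_ge0 le_sup.
move=> /cont [e /= e0 Be].
have : T (sup T + e / 2).
  split; first by rewrite addr_ge0// divr_ge0// ltW.
  apply: Be; rewrite /= opprD addrA subrr sub0r normrN gtr0_norm; last lra.
  lra.
by move=> /le_sup; lra.
Qed.

End convex_bodies.

(** * Inscribed cubes and short chords *)

Definition cube {R : realType} {n : nat} (z : 'rV[R]_n) (rho : R) :
  set 'rV[R]_n := [set y | forall i, `|y 0 i - z 0 i| <= rho].

Section continuity_of_determinant.
Context {R : realType} {T : topologicalType}.

Lemma continuous_subr_cst (f : T -> R) (c : R) :
  continuous f -> continuous (fun v => f v - c).
Proof. by move=> cf v; apply: cvgB; [exact: cf|exact: cvg_cst]. Qed.

Lemma continuous_abs (f : T -> R) :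
  continuous f -> continuous (fun v => `|f v|).
Proof. by move=> cf v; apply: cvg_norm; exact: cf. Qed.

Lemma continuous_bigsum (I : Type) (s : seq I) (f : I -> T -> R) :
  (forall i, continuous (f i)) -> continuous (fun v => \sum_(i <- s) f i v).
Proof.
move=> cf; elim: s => [|a s IH].
  by under eq_fun do rewrite big_nil; exact: cst_continuous.
under eq_fun do rewrite big_cons.
by move=> v; apply: cvgD; [exact: cf|exact: IH].
Qed.

Lemma continuous_bigprod (I : Type) (s : seq I) (f : I -> T -> R) :
  (forall i, continuous (f i)) -> continuous (fun v => \prod_(i <- s) f i v).
Proof.
move=> cf; elim: s => [|a s IH].
  by under eq_fun do rewrite big_nil; exact: cst_continuous.
under eq_fun do rewrite big_cons.
by move=> v; apply: cvgM; [exact: cf|exact: IH].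
Qed.

Lemma continuous_det n (A : T -> 'M[R]_n) :
  (forall i j, continuous (fun v => A v i j)) -> continuous (fun v => \det (A v)).
Proof.
move=> cA; rewrite /determinant; apply: continuous_bigsum => s.
move=> v; apply: cvgM; first exact: cvg_cst.
by apply: continuous_bigprod => i; exact: cA.
Qed.

End continuity_of_determinant.

Lemma continuous_entry (R : realType) (n m : nat) (i : 'I_m) (k : 'I_n) :
  continuous (fun v : 'rV['rV[R]_n]_m => v 0 i 0 k).
Proof.
move=> v; apply: (@continuous_comp _ _ _ (fun v : 'rV['rV[R]_n]_m => v 0 i)
  (fun u : 'rV[R]_n => u 0 k)); last exact: coord_continuous.
move=> B nB; exists (fun _ j => if j == i then B else setT) => [a j|w /(_ 0 i)].
  by rewrite ord1; case: eqP => [->|_] //; exact: filterT.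
by rewrite eqxx.
Qed.

Section simplex.
Context {R : realType} {n : nat}.
Implicit Types (K : set 'rV[R]_n) (q y z : 'rV[R]_n).

(** For the induction the total weight is bounded by a parameter [l]; the sum is
    then [l] times the displacement from [q] to a point of [K]. *)
Lemma convex_simplex K q (I : Type) (p : I -> 'rV[R]_n) (s : seq I) (c : I -> R) :
  convex_set K -> K q -> (forall i, K (p i)) -> (forall i, 0 <= c i) ->
  \sum_(i <- s) c i <= 1 -> K (q + \sum_(i <- s) c i *: (p i - q)).
Proof.
move=> cK Kq Kp c0 c1.
suff: forall l : R, l <= 1 -> \sum_(i <- s) c i <= l ->
    exists2 w, K w & l *: (w - q) = \sum_(i <- s) c i *: (p i - q).
  by move=> /(_ 1 (lexx _) c1)[w Kw <-]; rewrite scale1r addrC subrK.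
move=> l _; elim: s l {c1} => [|a s IH] l.
  by rewrite !big_nil => _; exists q; rewrite // subrr scaler0.
rewrite !big_cons => sl.
have s0 : 0 <= \sum_(i <- s) c i by exact: sumr_ge0.
have [|w Kw wE] := IH (l - c a); first by lra.
have [l0|l0] := eqVneq l 0.
  have ca : c a = 0 by have := c0 a; lra.
  by exists q; rewrite // -wE l0 ca subr0 !scale0r addr0.
have {}l0 : 0 < l by rewrite lt_neqAle eq_sym l0 /=; have := c0 a; lra.
exists (w + (c a / l) *: (p a - w)).
  apply: convex_segment => //; rewrite divr_ge0 ?(ltW l0)//=.
  by rewrite ler_pdivrMr// mul1r; lra.
rewrite -wE; apply/rowP => i; rewrite !mxE; field; exact: lt0r_neq0.
Qed.

(** Among the simplices with vertex [q] and the other vertices in [K], one of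
    maximal volume. The barycentric coordinates of a point of [K] with respect
    to it are at most 1 in absolute value: by Cramer's rule they are the ratios
    of the volumes obtained by moving one vertex to that point. *)
Lemma maximal_simplex K q (eta : R) : compact K -> 0 < eta -> cube q eta `<=` K ->
  exists (p : 'I_n -> 'rV[R]_n) (M : 'M[R]_n),
    [/\ forall i, K (p i), forall i, row i M = p i - q, M \in unitmx &
        forall y, K y -> forall i, `|((y - q) *m invmx M) 0 i| <= 1].
Proof.
move=> cK eta0 qK.
pose S := [set v : 'rV['rV[R]_n]_n | forall i, K (v ord0 i)].
have cS : compact S by exact: (@rV_compact 'rV[R]_n n (fun=> K)).
pose mat (v : 'rV['rV[R]_n]_n) : 'M[R]_n := \matrix_(i, k) (v 0 i 0 k - q 0 k).
pose F v := `|\det (mat v)|.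
have cD : continuous (fun v => \det (mat v)).
  apply: continuous_det => i k; rewrite /mat; under eq_fun do rewrite mxE.
  apply: continuous_subr_cst; exact: continuous_entry.
have cF : continuous F by exact: continuous_abs.
pose v0 : 'rV['rV[R]_n]_n := \row_i (q + eta *: delta_mx 0 i).
have Sv0 : S v0.
  move=> i; rewrite mxE; apply: qK => k; rewrite !mxE eqxx/= addrAC subrr add0r.
  by case: (k == i); rewrite ?mulr1 ?mulr0 ?normr0 ?gtr0_norm// ltW.
have Fv0 : 0 < F v0.
  have -> : F v0 = `|\det (eta%:M : 'M[R]_n)|.
    congr (`|\det _|); apply/matrixP => i k; rewrite !mxE eqxx/= addrAC subrr add0r.
    by rewrite eq_sym mulr_natr.
  by rewrite normr_gt0 det_scalar expf_neq0// gt_eqF.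
have [|v vS vmax] := compact_EVT_max (ex_intro _ _ Sv0) cS (f := F).
  exact: continuous_subspaceT.
move: vS; rewrite inE => Sv.
pose M := mat v.
have detM : \det M != 0.
  by rewrite -normr_gt0 (lt_le_trans Fv0)// vmax// inE.
exists (fun i => v 0 i), M; split=> //.
- by move=> i; apply/rowP => k; rewrite !mxE.
- by rewrite unitmxE unitfE.
move=> y Ky i.
pose v' : 'rV['rV[R]_n]_n := \row_k (if k == i then y else v 0 k).
have Sv' : S v' by move=> k; rewrite mxE; case: ifP => // _; exact: Sv.
have cof k : cofactor (mat v') i k = cofactor M i k.
  rewrite /cofactor; congr (_ * \det _); apply/matrixP => a b.
  by rewrite !mxE eq_sym (negbTE (neq_lift _ _)).
have detv' : \det (mat v') = \det M * ((y - q) *m invmx M) 0 i.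
  rewrite (expand_det_row _ i) /invmx unitmxE unitfE detM -scalemxAr !mxE.
  rewrite mulrA divff// mul1r; apply: eq_bigr => k _.
  by rewrite cof !mxE eqxx.
have : F v' <= F v by apply: vmax; rewrite inE.
rewrite /F detv' normrM -/M -[leRHS]mulr1 ler_pM2l//.
by rewrite normr_gt0.
Qed.

End simplex.

(** The part of John's theorem that is used below. Take the barycentric
    coordinate, of a maximal simplex, whose gradient is largest (column [i0] of
    [G]), and the largest entry [j] of that gradient. This coordinate stays in
    [[-1, 1]] on [K], so that chords along [j] are short; all the coordinates
    vary slowly on a cube around the barycentre, of a size given by the same
    gradient, so that the cube stays in the simplex. *)
Lemma cube_and_short_chords (R : realType) (m : nat) (K : set 'rV[R]_m.+1) q
    (eta : R) : compact K -> convex_set K -> 0 < eta -> cube q eta `<=` K ->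
  exists z rho j, [/\ 0 < rho, cube z rho `<=` K &
    forall y t, K y -> K (y + t *: delta_mx 0 j) ->
      `|t| <= 2 * m.+1%:R ^+ 2 * m.+2%:R * rho].
Proof.
move=> cK convK eta0 qK.
have [p [M [Kp rowM Mu coord1]]] := maximal_simplex cK eta0 qK.
have Kq : K q by apply: qK => i; rewrite subrr normr0 ltW.
pose G := invmx M.
pose N i := \sum_k `|G k i|.
pose i0 := [arg max_(i > ord0) N i]%O.
have Nmax i : N i <= N i0 by rewrite /i0; case: arg_maxP => // ? _; exact.
pose j := [arg max_(k > ord0) `|G k i0|]%O.
have Gmax k : `|G k i0| <= `|G j i0| by rewrite /j; case: arg_maxP => // ? _; exact.
have NG : N i0 <= m.+1%:R * `|G j i0|.
  apply: le_trans (ler_sum _ (fun k _ => Gmax k)) _.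
  by rewrite sumr_const card_ord mulr_natl.
have N_gt0 : 0 < N i0.
  rewrite lt_neqAle sumr_ge0// andbT eq_sym; apply/negP => /eqP N0.
  have G0 : G = 0.
    apply/matrixP => k i; rewrite mxE; apply/eqP; rewrite -normr_le0 -N0.
    by apply: le_trans (Nmax i); rewrite /N (bigD1 k)//= lerDl sumr_ge0.
  have := mulmxV Mu; rewrite -/G G0 mulmx0 => /matrixP/(_ 0 0)/esym/eqP.
  by rewrite !mxE oner_eq0.
have m1 : 0 < m.+1%:R :> R by rewrite ltr0n.
have m2 : 0 < m.+2%:R :> R by rewrite ltr0n.
pose rho := (m.+1%:R * m.+2%:R * N i0)^-1.
have rho0 : 0 < rho by rewrite invr_gt0 !mulr_gt0.
pose b : 'rV[R]_m.+1 := const_mx m.+2%:R^-1.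
pose z := q + b *m M.
exists z, rho, j; split=> //.
- move=> y yz; pose c := (y - q) *m G.
  have cE i : `|c 0 i - m.+2%:R^-1| <= (m.+1%:R * m.+2%:R)^-1.
    have -> : c 0 i - m.+2%:R^-1 = ((y - z) *m G) 0 i.
      rewrite /z opprD addrA mulmxBl mulmxK// !mxE; congr (_ - _).
    rewrite mxE; apply: le_trans (ler_norm_sum _ _ _) _.
    apply: (@le_trans _ _ (rho * N i)).
      rewrite mulr_sumr; apply: ler_sum => k _; rewrite normrM ler_wpM2r//.
      by have := yz k; rewrite !mxE.
    apply: (@le_trans _ _ (rho * N i0)); first by rewrite ler_pM2l.
    by rewrite /rho invfM -mulrA mulVf ?mulr1// gt_eqF.
  have m12 : (m.+1%:R * m.+2%:R)^-1 <= m.+2%:R^-1 :> R.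
    rewrite lef_pV2 ?posrE ?mulr_gt0// ler_peMl ?(ltW m2)//.
    by rewrite ler1n.
  have c0 i : 0 <= c 0 i.
    have := cE i; rewrite ler_norml lerBrDr => /andP[+ _]; apply: le_trans.
    by rewrite addrC subr_ge0.
  have c1 : \sum_i c 0 i <= 1.
    apply: (@le_trans _ _ (\sum_(i < m.+1) (m.+2%:R^-1 + (m.+1%:R * m.+2%:R)^-1))).
      apply: ler_sum => i _; have := cE i; rewrite ler_norml => /andP[_].
      by rewrite lerBlDr addrC.
    rewrite sumr_const card_ord -[leLHS]mulr_natl le_eqVlt; apply/orP; left.
    apply/eqP; rewrite invfM mulrDr mulVKf ?lt0r_neq0//.
    by rewrite -[X in _ + X]mul1r -mulrDl natr1 divff ?lt0r_neq0.
  have -> : y = q + \sum_i c 0 i *: (p i - q).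
    under eq_bigr do rewrite -rowM.
    by rewrite -mulmx_sum_row mulmxKV// addrC subrK.
  by apply: convex_simplex.
- move=> y t Ky Kyt.
  have H1 := coord1 _ Ky i0; have H2 := coord1 _ Kyt i0.
  have tG : `|t * G j i0| <= 2.
    have -> : t * G j i0 = ((y + t *: delta_mx 0 j - q) *m invmx M) 0 i0
        - ((y - q) *m invmx M) 0 i0.
      rewrite addrAC mulmxDl -scalemxAl [in RHS]mxE addrAC subrr add0r mxE.
      by congr (_ * _); rewrite -rowE mxE.
    by apply: le_trans (ler_normB _ _) _; rewrite -[2]/(1 + 1) lerD.
  rewrite normrM in tG.
  have : `|t| * N i0 <= 2 * m.+1%:R.
    apply: le_trans (ler_wpM2l (normr_ge0 _) NG) _.
    by rewrite mulrCA mulrC ler_pM2r.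
  rewrite -ler_pdivlMr// => /le_trans; apply.
  rewrite le_eqVlt; apply/orP; left; apply/eqP; rewrite /rho.
  by field; rewrite !gt_eqF.
Qed.

(** * Lower bounds for integrals and for areas of graphs *)

(** The integral of a nonnegative function is a supremum over simple functions,
    one of which is [c] times the indicator function of [X]. *)
Lemma integral_ge_const d (T : measurableType d) (R : realType)
    (mu : {measure set T -> \bar R}) (D X : set T) (f : T -> \bar R) (c : R) :
  measurable X -> X `<=` D -> 0 <= c ->
  (forall x, D x -> 0 <= f x)%E -> (forall x, X x -> c%:E <= f x)%E ->
  (c%:E * mu X <= \int[mu]_(x in D) f x)%E.
Proof.
move=> mX XD c0 f0 fc; rewrite -integral_cst// !ge0_integralE//.
  apply: ge_ereal_sup => _ [h /= hX <-]; apply: ereal_sup_ubound.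
  exists h => //= x; apply: le_trans (hX x) _; rewrite /patch.
  case: ifPn => [|_]; first by rewrite inE => Xx; rewrite mem_set ?fc//; exact: XD.
  by case: ifPn => //; rewrite inE; exact: f0.
Qed.

Lemma hausdorff_integral_ge_const (R : realType) (n k : nat)
    (D X : set 'rV[R]_n) (f : 'rV[R]_n -> \bar R) (c m : R) :
  closed X -> X `<=` D -> 0 <= c -> 0 <= m -> (m%:E <= hausdorff k X)%E ->
  (forall x, D x -> 0 <= f x)%E -> (forall x, X x -> c%:E <= f x)%E ->
  ((c * m)%:E <= \int[hausdorff_measure k]_(x in D) f x)%E.
Proof.
move=> clX XD c0 m0 mX f0 fc.
have XM : measurable (X : set (caratheodory_type (@hausdorff R n k))).
  exact: closed_caratheodory.
apply: le_trans (integral_ge_const _ XM XD c0 f0 fc).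
by rewrite EFinM lee_pmul ?lee_fin.
Qed.

Lemma closed_box (R : realType) (n : nat) (a b : 'I_n -> R) :
  closed [set y : 'rV[R]_n | forall i, a i <= y 0 i <= b i].
Proof.
have -> : [set y : 'rV[R]_n | forall i, a i <= y 0 i <= b i] =
    \bigcap_(i in [set: 'I_n]) ((fun y : 'rV[R]_n => y 0 i) @^-1` `[a i, b i]).
  apply/seteqP; split=> [y yab i _|y yab i].
    by rewrite /= in_itv/=; exact: yab.
  by have := yab i Logic.I; rewrite /= in_itv.
apply: closed_bigI => i _; apply: preimage_closed; last exact: itv_closed.
by move=> y _; exact: coord_continuous.
Qed.

Section graphs.
Context {R : realType} {d : nat}.
Implicit Types (Omega : set 'rV[R]_d.+1) (j : 'I_d.+1) (u : 'I_d -> R).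

Definition point_over j (h : R) u : 'rV[R]_d.+1 := \row_i oapp u h (unlift j i).

Lemma point_over_lift j h u k : point_over j h u 0 (lift j k) = u k.
Proof. by rewrite mxE liftK. Qed.

Lemma point_over_axis j h u : point_over j h u 0 j = h.
Proof. by rewrite mxE unlift_none. Qed.

Lemma delta_lift j k : (delta_mx 0 j : 'rV[R]_d.+1) 0 (lift j k) = 0.
Proof. by rewrite mxE eqxx eq_sym (negbTE (neq_lift _ _)). Qed.

Lemma delta_axis j : (delta_mx 0 j : 'rV[R]_d.+1) 0 j = 1.
Proof. by rewrite mxE !eqxx. Qed.

Lemma delta_neq0 j : (delta_mx 0 j : 'rV[R]_d.+1) != 0.
Proof.
by apply/eqP => /rowP/(_ j); rewrite delta_axis mxE => /eqP; rewrite oner_eq0.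
Qed.

Lemma forall_axis (P : 'I_d.+1 -> Prop) j :
  P j -> (forall k, P (lift j k)) -> forall i, P i.
Proof. by move=> Pj Pl i; case: (unliftP j i) => [k ->|->]. Qed.

Lemma dot_axis j (u v : 'rV[R]_d.+1) :
  dot u v = u 0 j * v 0 j + \sum_k u 0 (lift j k) * v 0 (lift j k).
Proof. by rewrite /dot (bigD1_ord j). Qed.

(** The chords that leave [Omega] from the points over a cube end at points which
    project onto this cube. *)
Lemma graph_area Omega (A : set 'rV[R]_d.+1) j (h e l : R) (c : 'I_d -> R) :
  (0 < d)%N -> compact Omega -> e != 0 -> 0 < l ->
  (forall u, (forall k, `|u k - c k| <= l) -> Omega (point_over j h u)) ->
  (forall u t, (forall k, `|u k - c k| <= l) -> 0 <= t ->
     boundary Omega (point_over j h u + t *: (e *: delta_mx 0 j)) ->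
     A (point_over j h u + t *: (e *: delta_mx 0 j))) ->
  ((area_const R d * l ^+ d)%:E <= hausdorff d A)%E.
Proof.
move=> d0 cO e0 l0 Ou OA.
apply: (@hausdorff_ge_cube _ _ _ (lift j) _ c) => // u uc.
have [|t t0 bt] := ray_meets_boundary (v := e *: delta_mx 0 j) cO (Ou u uc).
  by rewrite scaler_eq0 negb_or e0 delta_neq0.
exists (point_over j h u + t *: (e *: delta_mx 0 j)); first exact: OA.
by move=> k; rewrite !mxE liftK/= eq_sym (negbTE (neq_lift _ _)) !mulr0 addr0.
Qed.

End graphs.

Lemma boundary_closed (T : topologicalType) (A : set T) : closed (boundary A).
Proof.
by apply: closedI; [exact: closed_closure|apply: open_closedC; exact: open_interior].
Qed.

Lemma boundary_sub (T : topologicalType) (A : set T) : closed A -> boundary A `<=` A.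
Proof. by move=> cA x [+ _]; rewrite -(closure_id A).1. Qed.

Section unit_vectors.
Context {R : realType} {n : nat}.
Implicit Types u : 'rV[R]_n.

Lemma sum_abs_unit u : dot u u = 1 -> 1 <= \sum_i `|u 0 i|.
Proof. by move=> u1; have := enorm_le_sum u; rewrite /enorm u1 sqrtr1. Qed.

Lemma coord_unit_le1 u i : dot u u = 1 -> `|u 0 i| <= 1.
Proof. by move=> u1; have := coord_le_enorm u i; rewrite /enorm u1 sqrtr1. Qed.

End unit_vectors.

(** * Thin bodies have large Willmore energy *)

(** The pieces are cut out by closed conditions, which makes them measurable. As
    chords along [j] through the cube of centre [z] and half-side [rho] will have
    length at most [C * rho], the bounds on coordinate [j] amount to saying on
    which side of the centre the point lies. *)
Definition upper_piece {R : realType} {n : nat} (Omega : set 'rV[R]_n)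
    (z : 'rV[R]_n) (rho C : R) (j : 'I_n) : set 'rV[R]_n :=
  boundary Omega `&` [set x : 'rV[R]_n | forall i,
    (if i == j then z 0 j else z 0 i - rho / 4) <= x 0 i
    <= (if i == j then z 0 j + C * rho else z 0 i + rho / 4)].

Definition lower_piece {R : realType} {n : nat} (Omega : set 'rV[R]_n)
    (z : 'rV[R]_n) (rho C : R) (j : 'I_n) (x : 'rV[R]_n) : set 'rV[R]_n :=
  boundary Omega `&` [set y : 'rV[R]_n | forall i,
    (if i == j then z 0 j - C * rho else x 0 i - rho / 4) <= y 0 i
    <= (if i == j then z 0 j else x 0 i + rho / 4)].

Section thin_bodies.
Context {R : realType} {d : nat}.
Variables (Omega : set 'rV[R]_d.+1) (z : 'rV[R]_d.+1) (rho C : R) (j : 'I_d.+1).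
Hypotheses (hd : (0 < d)%N) (cO : compact Omega) (convO : convex_set Omega)
  (smO : smooth_boundary Omega) (rho0 : 0 < rho) (zO : cube z rho `<=` Omega)
  (C1 : 1 <= C).
Hypothesis chord : forall y t, cube z rho y -> Omega (y + t *: delta_mx 0 j) ->
  `|t| <= C * rho.

Let N := outward_normal Omega.

Let clO : closed Omega.
Proof. by apply: compact_closed => //; exact: norm_hausdorff. Qed.

(** The supporting hyperplane at [y] passes below the cube. Testing it with the
    points of the cube at height [z 0 j], displaced horizontally along the normal,
    bounds the horizontal part of the normal by its vertical part. *)
Lemma lower_normal y : boundary Omega y ->
  (forall k, `|y 0 (lift j k) - z 0 (lift j k)| <= rho / 2) ->
  z 0 j - C * rho <= y 0 j <= z 0 j -> N y 0 j <= - (2 * C + 1)^-1.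
Proof.
have r0 := rho0; have c1 := C1; move=> by_ yz /andP[yjl yjz].
have supp w : Omega w -> dot (w - y) (N y) <= 0 by exact: outward_normal_supports.
have half : rho / 2 <= rho by lra.
have := supp (point_over j (z 0 j + rho) (fun k => y 0 (lift j k))).
rewrite (dot_axis j) !mxE unlift_none/= big1 => [|k _]; last first.
  by rewrite !mxE liftK/= subrr mul0r.
rewrite addr0 => Hup.
have {Hup} : (z 0 j + rho - y 0 j) * N y 0 j <= 0.
  apply: Hup; apply: zO; apply: (forall_axis (j := j)) => [|k].
    by rewrite point_over_axis addrAC subrr add0r gtr0_norm.
  by rewrite point_over_lift; exact: le_trans (yz k) half.
rewrite pmulr_rle0; last by lra.
move=> Nj0.
pose sg k := Num.sg (N y 0 (lift j k)).
have := supp (point_over j (z 0 j) (fun k => y 0 (lift j k) + rho / 2 * sg k)).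
rewrite (dot_axis j) !mxE unlift_none/= => Hside.
have {Hside} : (z 0 j - y 0 j) * N y 0 j +
    \sum_k (rho / 2 * `|N y 0 (lift j k)|) <= 0.
  rewrite (eq_bigr (fun k => (point_over j (z 0 j) (fun k => y 0 (lift j k) +
     rho / 2 * sg k) - y) 0 (lift j k) * N y 0 (lift j k))); last first.
    move=> k _; rewrite !mxE liftK/= addrAC subrr add0r.
    by rewrite normrEsg mulrA.
  apply: Hside; apply: zO; apply: (forall_axis (j := j)) => [|k].
    by rewrite point_over_axis subrr normr0 ltW.
  rewrite point_over_lift addrAC; apply: le_trans (ler_normD _ _) _.
  have : `|rho / 2 * sg k| <= rho / 2.
    rewrite normrM gtr0_norm ?divr_gt0// /sg normr_sg.
    by case: (_ != 0); rewrite ?mulr1 ?mulr0 ?divr_ge0// ltW.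
  by have := yz k; lra.
rewrite -mulr_sumr => Hs.
have := sum_abs_unit (outward_normal_unit smO by_); rewrite -/N (bigD1_ord j)//=.
rewrite (ler0_norm Nj0); set S := \sum_(k < d) _ in Hs *.
have {Hs} : S <= 2 * C * - N y 0 j.
  rewrite -(ler_pM2l (_ : 0 < rho / 2)) ?divr_gt0//.
  have : (C * rho) * N y 0 j <= (z 0 j - y 0 j) * N y 0 j.
    by rewrite ler_wnM2r//; lra.
  set Nj := N y 0 j in Hs *; move=> H.
  have -> : rho / 2 * (2 * C * - Nj) = - (C * rho * Nj) by field.
  lra.
move=> SC S1.
have C0 : 0 < 2 * C + 1 by lra.
rewrite lerNr -div1r ler_pdivrMr//.
have -> : - N y 0 j * (2 * C + 1) = 2 * C * - N y 0 j + - N y 0 j by ring.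
lra.
Qed.

Let top := upper_piece Omega z rho C j.
Let bottom := lower_piece Omega z rho C j.

Let top_axis x : top x -> z 0 j <= x 0 j <= z 0 j + C * rho.
Proof. by case=> _ /(_ j); rewrite eqxx. Qed.

Let top_lift x k : top x -> `|x 0 (lift j k) - z 0 (lift j k)| <= rho / 4.
Proof.
case=> _ /(_ (lift j k)); rewrite eq_sym (negbTE (neq_lift _ _)) ler_norml; lra.
Qed.

Let bottom_axis x y : bottom x y -> z 0 j - C * rho <= y 0 j <= z 0 j.
Proof. by case=> _ /(_ j); rewrite eqxx. Qed.

Let bottom_lift x y k : bottom x y -> `|y 0 (lift j k) - x 0 (lift j k)| <= rho / 4.
Proof.
case=> _ /(_ (lift j k)); rewrite eq_sym (negbTE (neq_lift _ _)) ler_norml; lra.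
Qed.

Let chord_over (e t : R) u : (forall k, `|u k - z 0 (lift j k)| <= rho) -> 0 <= t ->
  `|e| = 1 -> boundary Omega (point_over j (z 0 j) u + t *: (e *: delta_mx 0 j)) ->
  t <= C * rho.
Proof.
move=> uz t0 e1; rewrite scalerA => /(boundary_sub clO) /chord.
rewrite normrM e1 mulr1 (ger0_norm t0); apply.
apply: (forall_axis (j := j)) => [|k];
  last by rewrite point_over_lift.
by rewrite point_over_axis subrr normr0 ltW.
Qed.

Let over_cube u : (forall k, `|u k - z 0 (lift j k)| <= rho) ->
  Omega (point_over j (z 0 j) u).
Proof.
move=> uz; apply: zO; apply: (forall_axis (j := j)) => [|k];
  last by rewrite point_over_lift.
by rewrite point_over_axis subrr normr0 ltW.
Qed.

Lemma top_area : ((area_const R d * (rho / 4) ^+ d)%:E <= hausdorff d top)%E.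
Proof.
have r0 := rho0.
have near u : (forall k, `|u k - z 0 (lift j k)| <= rho / 4) ->
    forall k, `|u k - z 0 (lift j k)| <= rho.
  by move=> H k; apply: le_trans (H k) _; lra.
apply: (@graph_area _ _ Omega _ j (z 0 j) 1 _ (fun k => z 0 (lift j k))) => //.
- by rewrite divr_gt0.
- by move=> u /near; exact: over_cube.
move=> u t uz t0 bt; split=> //; have tC := chord_over (near _ uz) t0 (normr1 _) bt.
apply: (forall_axis (j := j)) => [|k]; rewrite scale1r mxE.
  by rewrite eqxx point_over_axis mxE delta_axis; lra.
rewrite eq_sym (negbTE (neq_lift _ _)) point_over_lift mxE delta_lift mulr0 addr0.
by have := uz k; rewrite ler_norml; lra.
Qed.

Lemma bottom_area x : top x ->
  ((area_const R d * (rho / 4) ^+ d)%:E <= hausdorff d (bottom x))%E.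
Proof.
have r0 := rho0; move=> tx.
have near u : (forall k, `|u k - x 0 (lift j k)| <= rho / 4) ->
    forall k, `|u k - z 0 (lift j k)| <= rho.
  move=> H k; have := H k; have := top_lift k tx; rewrite !ler_norml; lra.
apply: (@graph_area _ _ Omega _ j (z 0 j) (-1) _ (fun k => x 0 (lift j k))) => //.
- by rewrite divr_gt0.
- by move=> u /near; exact: over_cube.
move=> u t ux t0 bt; split=> //.
have tC := chord_over (near _ ux) t0 (normrN1 _) bt.
apply: (forall_axis (j := j)) => [|k]; rewrite scaleN1r scalerN !mxE.
  by rewrite !eqxx unlift_none/=; lra.
rewrite eq_sym (negbTE (neq_lift _ _)) liftK/= mulr0 subr0.
by have := ux k; rewrite ler_norml; lra.
Qed.

(** The point [y0] of the bottom face of the cube below [x] is on the inner side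
    of the supporting hyperplane at [y], from which [x] is farther away: it lies
    higher by at least [rho], and the normal is directed downwards. *)
Lemma top_bottom_dot x y : top x -> bottom x y ->
  dot (x - y) (N y) <= - (rho / (2 * C + 1)).
Proof.
have r0 := rho0; have c1 := C1; move=> tx bxy; have [by_ _] := bxy.
have Ny : N y 0 j <= - (2 * C + 1)^-1.
  apply: lower_normal => //; last exact: bottom_axis bxy.
  move=> k; have := top_lift k tx; have := bottom_lift k bxy.
  by rewrite !ler_norml; lra.
pose y0 := point_over j (z 0 j - rho) (fun k => x 0 (lift j k)).
have Oy0 : Omega y0.
  apply: zO; apply: (forall_axis (j := j)) => [|k].
    by rewrite point_over_axis addrAC subrr add0r normrN gtr0_norm.
  by rewrite point_over_lift; apply: le_trans (top_lift k tx) _; lra.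
have Hy : dot (y0 - y) (N y) <= 0 by exact: outward_normal_supports.
have Hx : dot (x - y0) (N y) <= rho * N y 0 j.
  rewrite (dot_axis j) !mxE unlift_none/= big1 ?addr0 => [|k _]; last first.
    by rewrite !mxE liftK/= subrr mul0r.
  rewrite ler_wnM2r//; last by have := top_axis tx; lra.
  by apply: le_trans Ny _; rewrite oppr_le0 invr_ge0; lra.
have -> : x - y = (x - y0) + (y0 - y) by rewrite addrA subrK.
rewrite dotDl -[leRHS]addr0 lerD// (le_trans Hx)//.
by rewrite -mulrN ler_pM2l.
Qed.

Lemma top_bottom_dist x y : top x -> bottom x y ->
  enorm (x - y) <= 2 * C * d.+1%:R * rho.
Proof.
have r0 := rho0; have c1 := C1; move=> tx bxy.
rewrite -mulrA mulrC -mulrA; apply: enorm_le.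
have Crho : rho <= C * rho by rewrite ler_peMl// ltW.
apply: (forall_axis (j := j)) => [|k]; rewrite !mxE.
  have := top_axis tx; have := bottom_axis bxy; rewrite ler_norml; lra.
have := bottom_lift k bxy; rewrite distrC; lra.
Qed.

Variables (cs s p : R).
Hypotheses (cs0 : 0 < cs) (s0 : 0 < s) (p0 : 0 <= p).

Let a : R := d%:R + 1 + s.
Let mass : R := area_const R d * (rho / 4) ^+ d.
Let kappa : R := rho / (2 * C + 1) / (2 * C * d.+1%:R * rho) `^ a.

Let mass_ge0 : 0 <= mass.
Proof. by rewrite mulr_ge0 ?exprn_ge0 ?divr_ge0 ?(ltW (area_const_gt0 _ _)) ?ltW. Qed.

Let kappa_ge0 : 0 <= kappa.
Proof.
have r0 := rho0; have c1 := C1.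
by rewrite divr_ge0 ?powR_ge0// divr_ge0; lra.
Qed.

Lemma closed_upper_piece : closed top.
Proof. by apply: closedI; [exact: boundary_closed|exact: closed_box]. Qed.

Lemma closed_lower_piece x : closed (bottom x).
Proof. by apply: closedI; [exact: boundary_closed|exact: closed_box]. Qed.

(** The integrand of the fractional mean curvature is nonpositive on a convex
    body, so that the lower piece alone bounds the absolute value of the
    curvature from below. *)
Lemma curvature_lb x : top x ->
  ((cs * (kappa * mass))%:E <= `|frac_mean_curvature cs s Omega x|)%E.
Proof.
have r0 := rho0; have c1 := C1; move=> tx.
have Ox : Omega x by apply: boundary_sub => //; case: tx.
pose g y := - (dot (x - y) (N y) / enorm (x - y) `^ a).
have g0 y : boundary Omega y -> 0 <= g y.
  move=> by_; rewrite oppr_ge0 mulr_le0_ge0 ?invr_ge0 ?powR_ge0//.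
  exact: outward_normal_supports.
have gk y : bottom x y -> kappa <= g y.
  move=> bxy; have D := top_bottom_dot tx bxy.
  have dist := top_bottom_dist tx bxy.
  have k0 : 0 < rho / (2 * C + 1) by rewrite divr_gt0//; lra.
  have e0 : 0 < enorm (x - y).
    rewrite lt_neqAle enorm_ge0 andbT eq_sym; apply/negP => /eqP e0.
    have : dot (x - y) (N y) = 0.
      apply: big1 => i _; have := coord_le_enorm (x - y) i.
      by rewrite e0 normr_le0 => /eqP ->; rewrite mul0r.
    by move=> E; move: D; rewrite E leNgt oppr_lt0 k0.
  rewrite /g -mulNr; apply: ler_pM.
  - exact: ltW.
  - by rewrite invr_ge0 powR_ge0.
  - by rewrite lerNr.
  rewrite lef_pV2 ?posrE ?powR_gt0//; last exact: lt_le_trans dist.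
  by rewrite ge0_ler_powR ?nnegrE ?enorm_ge0 ?(le_trans (enorm_ge0 _) dist)//
    /a !addr_ge0// ltW.
have Ig : ((kappa * mass)%:E <=
    \int[hausdorff_measure d]_(y in boundary Omega) (g y)%:E)%E.
  apply: (@hausdorff_integral_ge_const _ _ _ (boundary Omega) (bottom x)
    (fun y => (g y)%:E)) => //.
  - exact: closed_lower_piece.
  - by move=> y [].
  - exact: bottom_area.
have -> : frac_mean_curvature cs s Omega x =
    (- (cs%:E * \int[hausdorff_measure d]_(y in boundary Omega) (g y)%:E))%E.
  rewrite /frac_mean_curvature -muleN -integral_ge0N; last first.
    by move=> y /g0; rewrite lee_fin.
  congr (_ * _)%E; apply: eq_integral => y _.
  by rewrite -EFinN /g opprK.
have I0 : (0 <= \int[hausdorff_measure d]_(y in boundary Omega) (g y)%:E)%E.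
  by apply: integral_ge0 => y /g0; rewrite lee_fin.
rewrite abseN gee0_abs; last by rewrite mule_ge0// lee_fin ltW.
by rewrite EFinM lee_pmul2l// lte_fin.
Qed.

Lemma willmore_lb : (((cs * (kappa * mass)) `^ p * mass)%:E <=
  frac_willmore cs s p Omega)%E.
Proof.
have k0 : 0 <= cs * (kappa * mass).
  by apply: mulr_ge0 (ltW cs0) (mulr_ge0 kappa_ge0 mass_ge0).
apply: (@hausdorff_integral_ge_const _ _ _ (boundary Omega) top
  (fun x => `|frac_mean_curvature cs s Omega x| `^ p)%E) => //.
- exact: closed_upper_piece.
- by move=> x [].
- exact: powR_ge0.
- exact: top_area.
- by move=> x _; exact: poweR_ge0.
move=> x /curvature_lb H; rewrite -poweR_EFin.
by apply: gt0_ler_poweR => //; rewrite in_itv/= leey andbT ?lee_fin.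
Qed.

End thin_bodies.

Definition willmore_const (R : realType) (d : nat) (cs s p C : R) : R :=
  let m := area_const R d / 4 ^+ d in
  (cs * ((2 * C + 1)^-1 / (2 * C * d.+1%:R) `^ (d%:R + 1 + s) * m)) `^ p * m.

Lemma willmore_const_gt0 (R : realType) (d : nat) (cs s p C : R) :
  0 < cs -> 1 <= C -> 0 < willmore_const d cs s p C.
Proof.
move=> cs0 C1.
have C0 : 0 < 2 * C * d.+1%:R by rewrite !mulr_gt0//; lra.
have C2 : 0 < (2 * C + 1)^-1 by rewrite invr_gt0; lra.
have m0 : 0 < area_const R d / 4 ^+ d by rewrite divr_gt0 ?area_const_gt0 ?exprn_gt0.
rewrite /willmore_const; apply: (mulr_gt0 _ m0); apply: powR_gt0.
apply: (mulr_gt0 cs0); apply: (mulr_gt0 _ m0); apply: (mulr_gt0 C2).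
by rewrite invr_gt0 powR_gt0.
Qed.

(** Areas scale like [rho ^+ d] and the curvature like [rho `^ (- s)]; collecting
    the powers of [rho] in [willmore_lb] leaves a factor that does not depend
    on the body. *)
Lemma willmore_ge_scale (R : realType) (d : nat) (Omega : set 'rV[R]_d.+1)
    (z : 'rV[R]_d.+1) (rho C : R) (j : 'I_d.+1) (cs s p : R) :
  (0 < d)%N -> compact Omega -> convex_set Omega -> smooth_boundary Omega ->
  0 < rho -> cube z rho `<=` Omega -> 1 <= C ->
  (forall y t, cube z rho y -> Omega (y + t *: delta_mx 0 j) -> `|t| <= C * rho) ->
  0 < cs -> 0 < s -> 0 <= p ->
  ((willmore_const d cs s p C * rho `^ (d%:R - s * p))%:E <=
   frac_willmore cs s p Omega)%E.
Proof.
move=> d0 cO convO smO rho0 zO C1 chord cs0 s0 p0.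
apply: le_trans (willmore_lb d0 cO convO smO rho0 zO C1 chord cs0 s0 p0).
rewrite lee_fin le_eqVlt; apply/orP; left; apply/eqP.
have C0 : 0 < 2 * C * d.+1%:R by rewrite !mulr_gt0//; lra.
have C2 : 0 < 2 * C + 1 by lra.
set m := area_const R d / 4 ^+ d.
have -> : area_const R d * (rho / 4) ^+ d = m * rho ^+ d.
  by rewrite expr_div_n /m mulrA mulrAC.
have m0 : 0 < m by rewrite divr_gt0 ?area_const_gt0 ?exprn_gt0.
have -> : (2 * C * d.+1%:R * rho) `^ (d%:R + 1 + s) =
    (2 * C * d.+1%:R) `^ (d%:R + 1 + s) * (rho ^+ d * rho * rho `^ s).
  rewrite powRM ?(ltW C0) ?(ltW rho0)//; congr (_ * _).
  rewrite [in LHS]powRD; last by rewrite (gt_eqF rho0) implybT.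
  rewrite [in LHS]powRD; last by rewrite (gt_eqF rho0) implybT.
  by rewrite powR_mulrn ?ltW// powRr1 ?ltW.
rewrite powRD; last by rewrite (gt_eqF rho0) implybT.
rewrite powR_mulrn ?(ltW rho0)// powRN powRrM.
set A := (2 * C * d.+1%:R) `^ _.
have A0 : 0 < A by exact: powR_gt0.
have rs : 0 < rho `^ s by exact: powR_gt0.
have rd : 0 < rho ^+ d by exact: exprn_gt0.
have -> : cs * (rho / (2 * C + 1) / (A * (rho ^+ d * rho * rho `^ s)) *
    (m * rho ^+ d)) = cs * ((2 * C + 1)^-1 / A * m) * (rho `^ s)^-1.
  by field; rewrite !gt_eqF.
rewrite powRM; last 2 first.
- apply: mulr_ge0 (ltW cs0) (mulr_ge0 _ (ltW m0)).
  by rewrite divr_ge0 ?invr_ge0 ?(ltW C2) ?(ltW A0).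
- by rewrite invr_ge0 ltW.
have -> : (rho `^ s)^-1 `^ p = (rho `^ s `^ p)^-1.
  by rewrite -(powR_inv1 (ltW rs)) -[LHS]powRrM mulN1r powRN.
rewrite /willmore_const -/m -/A; clearbody m; ring.
Qed.

(** * Fat bodies have large boundary area *)

(** The chords start in the cube and follow the coordinate direction closest to
    the normal at [x]; they leave [Omega] before they reach the supporting
    hyperplane at [x], hence not far from [x]. *)
Lemma fat_area (R : realType) (d : nat) (Omega : set 'rV[R]_d.+1)
    (x z : 'rV[R]_d.+1) (rho r : R) :
  (0 < d)%N -> compact Omega -> convex_set Omega -> smooth_boundary Omega ->
  boundary Omega x -> 0 < rho -> 0 <= r ->
  cube z rho `<=` Omega `&` cube x r ->
  ((area_const R d * rho ^+ d)%:E <=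
   hausdorff d (boundary Omega `&` cube x ((d.+1%:R ^+ 2 + 1) * r)))%E.
Proof.
move=> d0 cO convO smO bx rho0 r0 zOx.
have clO : closed Omega by apply: compact_closed => //; exact: norm_hausdorff.
set N := outward_normal Omega x.
have N1 : dot N N = 1 by exact: outward_normal_unit.
pose j := [arg max_(k > ord0) `|N 0 k|]%O.
have Nmax k : `|N 0 k| <= `|N 0 j| by rewrite /j; case: arg_maxP => // ? _; exact.
have n0 : 0 < d.+1%:R :> R by rewrite ltr0n.
have Nj : 1 <= d.+1%:R * `|N 0 j|.
  apply: le_trans (sum_abs_unit N1) _.
  apply: le_trans (ler_sum _ (fun k _ => Nmax k)) _.
  by rewrite sumr_const card_ord mulr_natl.
have Nj0 : 0 < `|N 0 j| by rewrite -(pmulr_rgt0 _ n0); exact: lt_le_trans Nj.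
have cz u : (forall k, `|u k - z 0 (lift j k)| <= rho) ->
    cube z rho (point_over j (z 0 j) u).
  move=> uz; apply: (forall_axis (j := j)) => [|k];
  last by rewrite point_over_lift.
  by rewrite point_over_axis subrr normr0 ltW.
apply: (@graph_area _ _ Omega _ j (z 0 j) (Num.sg (N 0 j)) rho
  (fun k => z 0 (lift j k))) => //.
- by rewrite sgr_eq0 -normr_gt0.
- by move=> u /cz/zOx[].
move=> u t /cz/zOx[_ wx] t0 bt; split=> //.
set w := point_over j (z 0 j) u in wx bt *.
have tr : t <= d.+1%:R ^+ 2 * r.
  have := outward_normal_supports clO convO smO bx (boundary_sub clO bt).
  rewrite -/N addrAC dotDl [X in _ + X]dotC scalerA dotZr.
  have -> : dot N (delta_mx 0 j) = N 0 j.
    rewrite (dot_axis j) delta_axis mulr1 big1 ?addr0// => k _.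
    by rewrite delta_lift mulr0.
  rewrite -mulrA -normrEsg => H.
  have H1 : - dot (w - x) N <= d.+1%:R * r.
    apply: le_trans (ler_norm _) _; rewrite normrN /dot.
    apply: le_trans (ler_norm_sum _ _ _) _.
    apply: (@le_trans _ _ (\sum_(i < d.+1) r)).
      apply: ler_sum => i _; rewrite normrM -[leRHS]mulr1.
      by apply: ler_pM => //; [have := wx i; rewrite !mxE|exact: coord_unit_le1].
    by rewrite sumr_const card_ord mulr_natl.
  have tN : t * `|N 0 j| <= d.+1%:R * r.
    by apply: le_trans H1; rewrite -subr_le0 opprK addrC.
  apply: (@le_trans _ _ (t * (d.+1%:R * `|N 0 j|))); first by rewrite ler_peMr.
  by rewrite mulrCA expr2 -mulrA ler_pM2l.
move=> i; apply: (@le_trans _ _ (`|w 0 i - x 0 i| + t)).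
  rewrite mxE addrAC (le_trans (ler_normD _ _))// lerD2l scalerA !mxE eqxx/=.
  rewrite normrM normrM (ger0_norm t0) normr_sg -mulrA ler_piMr//.
  by case: (_ != 0); case: (_ == _);
    rewrite !(mulr1n, mulr0n, normr1, normr0, mulr1, mulr0, ler01, lexx).
by rewrite mulrDl mul1r addrC lerD.
Qed.

(** * The two cases at a given scale *)

Lemma cube_homothety (R : realType) (n : nat) (Omega : set 'rV[R]_n)
    (x z : 'rV[R]_n) (rho t : R) : convex_set Omega -> Omega x ->
  cube z rho `<=` Omega -> 0 < t <= 1 ->
  cube (x + t *: (z - x)) (t * rho) `<=` Omega.
Proof.
move=> convO Ox zO /andP[t0 t1] y yz.
have tn0 := gt_eqF t0.
have -> : y = x + t *: ((z + t^-1 *: (y - (x + t *: (z - x)))) - x).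
  apply/rowP => i; rewrite !mxE; field; exact: lt0r_neq0.
apply: convex_segment => //; last by rewrite ltW.
apply: zO => i; have := yz i; rewrite !mxE => H.
rewrite addrAC subrr add0r normrM gtr0_norm ?invr_gt0// mulrC ler_pdivrMr//.
by rewrite [leRHS]mulrC.
Qed.

Lemma convex_cube (R : realType) (n : nat) (x : 'rV[R]_n) (r : R) :
  convex_set (cube x r).
Proof.
move=> y w l; rewrite !inE => yx wx i; have := yx i; have := wx i.
have -> : conv l y w = w + l%:num *: (y - w).
  rewrite /conv/= /unstable.onem scalerBl scale1r scalerBr addrC -addrA.
  by congr (_ + _); rewrite addrC.
have l0 : 0 <= l%:num by [].
have l1 : l%:num <= 1 by [].
rewrite !mxE !ler_norml => /andP[h1 h2] /andP[h3 h4]; apply/andP; split; nra.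
Qed.

Lemma closed_cube (R : realType) (n : nat) (x : 'rV[R]_n) (r : R) :
  closed (cube x r).
Proof.
have -> : cube x r = [set y : 'rV[R]_n | forall i, x 0 i - r <= y 0 i <= x 0 i + r].
  by apply/seteqP; split=> y yx i; have := yx i; rewrite /= ler_norml;
    move=> /andP[? ?]; apply/andP; split; lra.
exact: closed_box.
Qed.

Lemma convex_setI (R : realType) (n : nat) (A B : set 'rV[R]_n) :
  convex_set A -> convex_set B -> convex_set (A `&` B).
Proof.
move=> cA cB y w l; rewrite !inE => -[Ay By] [Aw Bw]; split.
  by have := cA y w l; rewrite !inE; exact.
by have := cB y w l; rewrite !inE; exact.
Qed.

(** A cube in the interior is shrunk towards [x]. *)
Lemma small_cube_near (R : realType) (n : nat) (Omega : set 'rV[R]_n)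
    (x : 'rV[R]_n) (r : R) : convex_set Omega -> interior Omega !=set0 ->
  Omega x -> 0 < r ->
  exists q eta, 0 < eta /\ cube q eta `<=` Omega `&` cube x r.
Proof.
move=> convO [q /nbhs_ballP[e /= e0 qO]] Ox r0.
have qO' : cube q (e / 2) `<=` Omega.
  move=> y yq; apply: qO; rewrite -ball_normE /= distrC.
  apply: (@le_lt_trans _ _ (e / 2)); last by lra.
  by apply/mx_norm_leP => [|i]; [lra|rewrite !mxE; exact: yq].
have D0 : 0 < `|q - x| + e by rewrite ltr_wpDl.
pose t := Num.min 1 (r / (`|q - x| + e)).
have t0 : 0 < t by rewrite lt_min ltr01 divr_gt0.
have t1 : t <= 1 by rewrite ge_min lexx.
exists (x + t *: (q - x)), (t * (e / 2)).
split; first by rewrite mulr_gt0// divr_gt0.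
move=> y yc; split; first by apply: cube_homothety yc => //; rewrite t0.
move=> i; have := yc i; rewrite !mxE => yi.
have qx : `|q 0 i - x 0 i| <= `|q - x|.
  by have := (mx_norm_leP (q - x) (normr_ge0 _)).1 (lexx _) i; rewrite !mxE.
have -> : y 0 i - x 0 i = (y 0 i - (x 0 i + t * (q 0 i - x 0 i))) + t * (q 0 i - x 0 i).
  by ring.
apply: le_trans (ler_normD _ _) _; rewrite normrM (gtr0_norm t0).
apply: (@le_trans _ _ (t * (`|q - x| + e))).
  rewrite [leRHS]mulrDr [leRHS]addrC lerD//; last by rewrite ler_pM2l.
  by apply: le_trans yi _; rewrite ler_pM2l//; lra.
by rewrite -ler_pdivlMr// ge_min lexx orbT.
Qed.

Lemma compact_setI_cube (R : realType) (n : nat) (Omega : set 'rV[R]_n) x r :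
  compact Omega -> compact (Omega `&` cube x r).
Proof. by move=> cO; apply: compact_closedI => //; exact: closed_cube. Qed.

Definition chord_const (R : realType) (d : nat) : R :=
  2 * d.+1%:R ^+ 2 * d.+2%:R.

Lemma chord_const_ge1 (R : realType) d : 1 <= chord_const R d.
Proof. by rewrite /chord_const -natrX -!natrM ler1n !muln_gt0. Qed.

(** The inscribed cube of [Omega `&` cube x r] is halved towards [x] in the second
    case: a chord of [Omega] through the new cube, if it left [cube x r], would
    contain a chord of [Omega `&` cube x r] of length [r / 2], which is too
    long. *)
Lemma fat_or_thin (R : realType) (d : nat) (Omega : set 'rV[R]_d.+1)
    (x : 'rV[R]_d.+1) (r : R) :
  convex_body Omega -> Omega x -> 0 < r ->
  (exists z rho, [/\ r <= 2 * chord_const R d * rho, 0 < rho &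
     cube z rho `<=` Omega `&` cube x r]) \/
  (exists z rho j, [/\ 0 < rho, rho < r, cube z rho `<=` Omega &
     forall y t, cube z rho y -> Omega (y + t *: delta_mx 0 j) ->
       `|t| <= 2 * chord_const R d * rho]).
Proof.
move=> [cO convO iO] Ox r0.
have [q [eta [eta0 qK]]] := small_cube_near convO iO Ox r0.
have cK : compact (Omega `&` cube x r) by exact: compact_setI_cube.
have convK : convex_set (Omega `&` cube x r).
  by apply: convex_setI => //; exact: convex_cube.
have [z [rho [j [rho0 zK chord]]]] := cube_and_short_chords cK convK eta0 qK.
have CC1 := chord_const_ge1 R d.
have {}chord y t : (Omega `&` cube x r) y ->
    (Omega `&` cube x r) (y + t *: delta_mx 0 j) -> `|t| <= chord_const R d * rho.
  exact: chord.
have [fat|thin] := leP (r / 2) (chord_const R d * rho).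
  by left; exists z, rho; split=> //; rewrite -mulrA; lra.
right; exists (x + 2^-1 *: (z - x)), (2^-1 * rho), j.
have Cr : rho <= chord_const R d * rho by rewrite ler_peMl// ltW.
have h01 : 0 < (2^-1 : R) <= 1 by rewrite invr_gt0 ltr0n/=; lra.
have zO' : cube (x + 2^-1 *: (z - x)) (2^-1 * rho) `<=` Omega.
  by apply: cube_homothety => // y /zK[].
split=> //; [by rewrite mulr_gt0// invr_gt0|lra|].
move=> y t yz Oyt.
have yx i : `|y 0 i - x 0 i| <= r / 2.
  pose w := z + 2 *: (y - (x + 2^-1 *: (z - x))).
  have /zK[_ /(_ i)] : cube z rho w.
    move=> k; have := yz k; rewrite !mxE !ler_norml => /andP[h1 h2].
    by apply/andP; split; lra.
  by rewrite !mxE !ler_norml => /andP[h1 h2]; apply/andP; split; lra.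
have Oy : Omega y by exact: zO'.
have near_chord u : `|u| <= r / 2 -> Omega (y + u *: delta_mx 0 j) ->
    `|u| <= chord_const R d * rho.
  move=> ur Ou; apply: (chord y).
    by split=> // i; apply: le_trans (yx i) _; lra.
  split=> // i; rewrite !mxE eqxx/= addrAC; apply: le_trans (ler_normD _ _) _.
  have : `|u * (i == j)%:R| <= `|u|.
    by rewrite normrM ler_piMr//; case: (_ == _); rewrite ?normr1 ?normr0.
  have := yx i; lra.
have [tr|rt] := leP `|t| (r / 2).
  by have := near_chord _ tr Oyt; lra.
exfalso.
have t0 : 0 < `|t| by lra.
pose lam := r / 2 / `|t|.
have lam0 : 0 <= lam by rewrite divr_ge0//; lra.
have lam1 : lam <= 1 by rewrite ler_pdivrMr// mul1r ltW.
have lamt : `|lam * t| = r / 2 by rewrite normrM ger0_norm// divfK ?gt_eqF.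
have : Omega (y + (lam * t) *: delta_mx 0 j).
  have -> : y + (lam * t) *: delta_mx 0 j =
      y + lam *: (y + t *: delta_mx 0 j - y) by rewrite addrAC subrr add0r scalerA.
  by apply: convex_segment => //; rewrite lam0.
by move=> /(near_chord _ _); rewrite lamt lexx leNgt thin => /(_ isT).
Qed.

Unset Implicit Arguments.

Theorem corollary1p2 (R : realType) (d : nat) (s p Lambda cs : R)
    (hd : (1 <= d)%N) (hs : 0 < s < 1) (hp : d%:R / s < p)
    (hLambda : 0 < Lambda) (hcs : 0 < cs) :
  exists c R0 : R, [/\ 0 < c, 0 < R0 &
    forall Omega : set 'rV[R]_d.+1,
      convex_body Omega -> smooth_boundary Omega ->
      (frac_willmore cs s p Omega <= Lambda%:E)%E ->
      forall x, boundary Omega x ->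
        (c%:E < ereal_inf
           [set ((r ^- d)%:E * hausdorff d (boundary Omega `&` eball x r))%E
           | r in [set r : R | (0 < r < R0)%R]])%E].
Proof.
have /andP[s0 _] := hs.
have CC1 := chord_const_ge1 R d.
have n0 : 1 <= d.+1%:R :> R by rewrite ler1n.
pose C := 2 * chord_const R d.
have C1 : 1 <= C by rewrite /C; lra.
pose B := willmore_const d cs s p C.
have B0 : 0 < B by exact: willmore_const_gt0.
have p0 : 0 < p by apply: le_lt_trans hp; rewrite divr_ge0// ltW.
pose e := s * p - d%:R.
have e0 : 0 < e by rewrite subr_gt0 mulrC -ltr_pdivrMr.
pose R0 := (B / Lambda) `^ e^-1.
have BL0 : 0 < B / Lambda by rewrite divr_gt0.
pose D : R := d.+1%:R ^+ 2 + 1.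
have D1 : 1 <= D by rewrite /D lerDr sqr_ge0.
pose M : R := 4 * d.+1%:R * D * chord_const R d.
have M0 : 0 < M by rewrite !mulr_gt0//; lra.
pose c := area_const R d / M ^+ d.
have c0 : 0 < c by rewrite divr_gt0 ?area_const_gt0 ?exprn_gt0.
exists (c / 2), R0; split; first by rewrite divr_gt0.
  exact: powR_gt0.
move=> Omega bodyO smO WL x bx.
have [cO convO iO] := bodyO.
have clO : closed Omega by apply: compact_closed => //; exact: norm_hausdorff.
apply: (@lt_le_trans _ _ c%:E); first by rewrite lte_fin; lra.
apply: le_ereal_inf_tmp => _ [r /= /andP[r0 rR0] <-].
pose r1 := r / (2 * d.+1%:R * D).
have nD1 : 1 <= d.+1%:R * D by exact: mulr_ege1.
have nD2 : 0 < 2 * d.+1%:R * D by rewrite -mulrA; lra.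
have r10 : 0 < r1 by rewrite divr_gt0.
have r1r : r1 <= r by rewrite ler_pdivrMr// ler_peMr ?ltW// -mulrA; lra.
case: (fat_or_thin bodyO (boundary_sub clO bx) r10) => [[z [rho [r1C rho0 zK]]]|].
  have H := fat_area hd cO convO smO bx rho0 (ltW r10) zK.
  have sub : boundary Omega `&` cube x (D * r1) `<=` boundary Omega `&` eball x r.
    move=> y [by_ yx]; split=> //; rewrite /eball/=.
    apply: (@le_lt_trans _ _ (d.+1%:R * (D * r1))).
      by apply: enorm_le => i; rewrite !mxE distrC; exact: yx.
    have -> : d.+1%:R * (D * r1) = r / 2.
      by rewrite /r1; field; rewrite !gt_eqF//; lra.
    lra.
  have {H} := le_trans H (le_outer_measure (@hausdorff R d.+1 d) _ _ sub).
  have rd0 : (0 <= (r ^- d)%:E)%E by rewrite lee_fin invr_ge0 exprn_ge0 ?ltW.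
  move=> /(lee_wpmul2l rd0); apply: le_trans; rewrite -EFinM lee_fin.
  rewrite /c mulrCA ler_pM2l ?area_const_gt0//.
  rewrite -!exprVn -exprMn lerXn2r ?nnegrE//.
  - by rewrite invr_ge0 ltW.
  - by rewrite mulr_ge0 ?invr_ge0 ?ltW.
  rewrite mulrC ler_pdivlMr// mulrC ler_pdivrMr//.
  have -> : r = r1 * (2 * d.+1%:R * D) by rewrite divfK// gt_eqF.
  have -> : rho * M = 2 * chord_const R d * rho * (2 * d.+1%:R * D).
    by rewrite /M; ring.
  by rewrite ler_pM2r.
move=> [z [rho [j [rho0 rhor1 zO chord]]]].
exfalso.
have := willmore_ge_scale hd cO convO smO rho0 zO C1 chord hcs s0 (ltW p0).
move=> /le_trans/(_ WL); rewrite lee_fin leNgt => /negP; apply.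
have -> : d%:R - s * p = - e by rewrite opprB.
rewrite powRN -/B -ltr_pdivrMl// [_ * Lambda]mulrC -invf_div.
rewrite ltf_pV2 ?posrE ?powR_gt0//.
have -> : B / Lambda = R0 `^ e by rewrite /R0 -powRrM mulVf ?gt_eqF// powRr1// ltW.
apply: gt0_ltr_powR; rewrite ?nnegrE ?powR_ge0 ?(ltW rho0)//.
exact: lt_trans rhor1 (le_lt_trans r1r rR0).
Qed.
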